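(* Let $(X,d)$ be a separable (possibly extended) metric space with the topology induced by $d$. If $(X,d)$ is complete, then the metric space $(\mathcal M(X),\mathsf{HK})$ is complete, where $\mathsf{HK}$ is the Hellinger-Kantorovich distance.
   Context: $\mathcal M(X)$ is the set of finite nonnegative Radon measures on $X$. Cone: $\mathfrak C$ is the quotient of $X\times[0,\infty)$ obtained by identifying all points $(x,0)$ with a single point $\mathfrak o$; classes are $[x,r]$. With $d_\pi=\min(d,\pi)$, $d_{\mathfrak C}^2([x_1,r_1],[x_2,r_2])=r_1^2+r_2^2-2r_1r_2\cos(d_\pi(x_1,x_2))$; $\mathfrak C$ carries the topology of the distance $d_{\mathfrak C}$. Put $\mathsf r([x,r])=r$, $\mathsf x([x,r])=x$ if $r>0$, $\mathsf x(\mathfrak o)=\bar x$ for a fixed arbitrary $\bar x\in X$; on $\mathfrak C\times\mathfrak C$, $\mathsf x_i,\mathsf r_i$ denote $\mathsf x,\mathsf r$ of the $i$-th component. For $\alpha\in\mathcal M(\mathfrak C\times\mathfrak C)$ with $\int(\mathsf r_1^2+\mathsf r_2^2)\,d\alpha<\infty$ ($\alpha\in\mathcal M_2(\mathfrak C\times\mathfrak C)$) set $\mathfrak h_i\alpha=(\mathsf x_i)_\sharp(\mathsf r_i^2\alpha)\in\mathcal M(X)$. The Hellinger-Kantorovich distance is $$\mathsf{HK}^2(\mu_1,\mu_2)=\min\Big\{\int d_{\mathfrak C}^2\,d\alpha:\ \alpha\in\mathcal M_2(\mathfrak C\times\mathfrak C),\ \mathfrak h_i\alpha=\mu_i,\ i=1,2\Big\}.$$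 *)

(* Defs.v *)
From HB Require Import structures.
From mathcomp Require Import all_boot all_order all_algebra.
From mathcomp Require Import all_classical all_reals all_analysis.
From mathcomp Require Import ring lra.

Set Implicit Arguments.
Unset Strict Implicit.
Unset Printing Implicit Defensive.

Import Order.TTheory GRing.Theory Num.Theory.
Import numFieldNormedType.Exports.

Local Open Scope classical_set_scope.
Local Open Scope ring_scope.
Local Open Scope quotient_scope.

(* A pseudoMetricType allows points at infinite distance: [edist] is the
   associated [\bar R]-valued distance, and the topology is the one it
   induces.  An extended metric space is a pseudoMetricType for which [edist]
   vanishes only on the diagonal. *)
Definition is_extended_metric (R : realType) (X : pseudoMetricType R) :=
  forall x y : X, edist (x, y) = 0%E -> x = y.

Definition separable (T : topologicalType) :=
  exists2 S : set T, countable S & dense S.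

Section truncated_distance.
Context {R : realType} {X : pseudoMetricType R}.

Definition dpi (x y : X) : R := fine (mine (edist (x, y)) pi%:E).

Lemma dpiE x y : (dpi x y)%:E = mine (edist (x, y)) pi%:E.
Proof.
rewrite /dpi fineK// ge0_fin_numE; last first.
  by rewrite le_min edist_ge0 lee_fin pi_ge0.
by rewrite gt_min ltry orbT.
Qed.

Lemma dpi_ge0 x y : 0 <= dpi x y.
Proof. by rewrite -lee_fin dpiE le_min edist_ge0 lee_fin pi_ge0. Qed.

Lemma dpi_le x y : dpi x y <= pi.
Proof. by rewrite -lee_fin dpiE ge_min lexx orbT. Qed.

Lemma dpi_sym x y : dpi x y = dpi y x.
Proof. by rewrite /dpi edist_sym. Qed.

Lemma dpi_refl x : dpi x x = 0.
Proof. by rewrite /dpi edist_refl min_l// lee_fin pi_ge0. Qed.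

Lemma dpi_triangle x y z : dpi x z <= dpi x y + dpi y z.
Proof.
have [h|h] := leP (edist (x, y)) pi%:E; last first.
  have -> : dpi x y = pi by rewrite /dpi min_r// ltW.
  by rewrite (le_trans (dpi_le _ _))// lerDl dpi_ge0.
have [h'|h'] := leP (edist (y, z)) pi%:E; last first.
  have -> : dpi y z = pi by rewrite /dpi min_r// ltW.
  by rewrite (le_trans (dpi_le _ _))// lerDr dpi_ge0.
rewrite -lee_fin EFinD !dpiE (min_l h) (min_l h') ge_min.
by rewrite edist_triangle.
Qed.

End truncated_distance.

Section law_of_cosines.
Context {R : realType}.
Implicit Types r s t a b c : R.

Definition cosine_law r s a : R := r ^+ 2 + s ^+ 2 - 2 * r * s * cos a.

Lemma cosine_lawE r s a : cosine_law r s a =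
  (r * cos a - s) ^+ 2 + (r * sin a) ^+ 2.
Proof. by have := cos2Dsin2 a; rewrite /cosine_law; nra. Qed.

Lemma cosine_law_ge0 r s a : 0 <= cosine_law r s a.
Proof. by rewrite cosine_lawE addr_ge0// sqr_ge0. Qed.

Lemma le_cosine_law r s a b : 0 <= r -> 0 <= s -> cos b <= cos a ->
  cosine_law r s a <= cosine_law r s b.
Proof.
move=> r0 s0 ba; rewrite /cosine_law lerD2l lerN2.
by rewrite ler_wpM2l// !mulr_ge0.
Qed.

Lemma plane_minkowski a b c d :
  Num.sqrt ((a + c) ^+ 2 + (b + d) ^+ 2) <=
  Num.sqrt (a ^+ 2 + b ^+ 2) + Num.sqrt (c ^+ 2 + d ^+ 2).
Proof.
rewrite -[leRHS]ger0_norm ?addr_ge0 ?sqrtr_ge0// -sqrtr_sqr ler_sqrt ?sqr_ge0//.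
rewrite [leRHS]sqrrD !sqr_sqrtr ?addr_ge0 ?sqr_ge0// -sqrtrM ?addr_ge0 ?sqr_ge0//.
suff : a * c + b * d <= Num.sqrt ((a ^+ 2 + b ^+ 2) * (c ^+ 2 + d ^+ 2)) by lra.
apply: le_trans (ler_norm _) _; rewrite -sqrtr_sqr ler_sqrt.
  by have := sqr_ge0 (a * d - b * c); lra.
by rewrite mulr_ge0// addr_ge0 ?sqr_ge0.
Qed.

Lemma cosine_law_triangle r s t a b c : 0 <= r -> 0 <= s -> 0 <= t ->
  0 <= a <= pi -> 0 <= b <= pi -> 0 <= c <= pi -> c <= a + b ->
  Num.sqrt (cosine_law r t c) <=
  Num.sqrt (cosine_law r s a) + Num.sqrt (cosine_law s t b).
Proof.
move=> r0 s0 t0 /andP[a0 api] /andP[b0 bpi] /andP[c0 cpi] cab.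
have cosle x y : 0 <= x -> x <= y -> y <= pi -> cos y <= cos x :> R.
  move=> x0; rewrite le_eqVlt => /predU1P[->//|xy] ypi.
  by rewrite ltW// ltr_cos// in_itv/= ?x0 ?ypi ?andbT;
    [exact: le_trans (ltW xy) _ | exact: le_trans x0 (ltW xy)].
have [b' [b'0 b'b cab' ab'pi]] :
    exists b', [/\ 0 <= b', b' <= b, c <= a + b' & a + b' <= pi].
  have [abpi|/ltW piab] := leP (a + b) pi; first by exists b.
  by exists (pi - a); split; lra.
apply: (@le_trans _ _ (Num.sqrt (cosine_law r t (a + b')))).
  by rewrite ler_sqrt ?cosine_law_ge0// le_cosine_law// cosle.
apply: (@le_trans _ _ (Num.sqrt (cosine_law r s a) +
                       Num.sqrt (cosine_law s t b'))); last first.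
  by rewrite lerD2l ler_sqrt ?cosine_law_ge0// le_cosine_law// cosle.
have := plane_minkowski (r * cos a - s) (r * sin a) (s - t * cos b') (t * sin b').
rewrite -cosine_lawE.
have -> : (s - t * cos b') ^+ 2 + (t * sin b') ^+ 2 = cosine_law s t b'.
  by have := cos2Dsin2 b'; rewrite /cosine_law; nra.
suff -> : (r * cos a - s + (s - t * cos b')) ^+ 2 + (r * sin a + t * sin b') ^+ 2
  = cosine_law r t (a + b') by [].
rewrite /cosine_law cosD.
have ha := cos2Dsin2 a; have hb := cos2Dsin2 b'.
transitivity (r ^+ 2 * (cos a ^+ 2 + sin a ^+ 2) +
  t ^+ 2 * (cos b' ^+ 2 + sin b' ^+ 2)
  - 2 * r * t * (cos a * cos b' - sin a * sin b')); first by ring.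
by rewrite ha hb; ring.
Qed.

End law_of_cosines.

Section cone.
Context {R : realType} {X : pseudoPMetricType R}.

Definition cone_rel (p q : X * {nonneg R}) : bool :=
  (p == q) || (p.2%:num == 0) && (q.2%:num == 0).

Lemma cone_rel_refl : reflexive cone_rel.
Proof. by move=> p; rewrite /cone_rel eqxx. Qed.

Lemma cone_rel_sym : symmetric cone_rel.
Proof. by move=> p q; rewrite /cone_rel eq_sym andbC. Qed.

Lemma cone_rel_trans : transitive cone_rel.
Proof.
move=> q p s; rewrite /cone_rel => /predU1P[->//|/andP[p0 q0]].
by move=> /predU1P[<-|/andP[_ s0]]; rewrite p0 ?q0 ?s0 orbT.
Qed.

Canonical cone_equiv :=
  EquivRel cone_rel cone_rel_refl cone_rel_sym cone_rel_trans.

End cone.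

Definition cone (R : realType) (X : pseudoPMetricType R) : Type :=
  {eq_quot (@cone_equiv R X)}.

HB.instance Definition _ (R : realType) (X : pseudoPMetricType R) :=
  EqQuotient.on (cone X).
HB.instance Definition _ (R : realType) (X : pseudoPMetricType R) :=
  Choice.on (cone X).

Section cone_metric.
Context {R : realType} {X : pseudoPMetricType R}.
Implicit Types (x y : X) (r s : {nonneg R}) (p q : cone X).

Definition cone_pi x r : cone X := \pi_(cone X) (x, r).

(* [repr] picks one of the pairs [(x, 0)] at the vertex. The definitions below
   do not depend on which one: see [cone_rad_pi], [cone_pt_pi] and
   [cone_dist_pi] for their values on the class of an arbitrary pair. *)
Definition cone_rad p : R := (repr p).2%:num.

Definition cone_pt (xbar : X) p : X :=
  if cone_rad p == 0 then xbar else (repr p).1.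

Definition cone_dist p q : R :=
  Num.sqrt (cosine_law (cone_rad p) (cone_rad q) (dpi (repr p).1 (repr q).1)).

Lemma repr_cone_pi x r : cone_rel (repr (cone_pi x r)) (x, r).
Proof. by apply/eqmodP; rewrite reprK. Qed.

Lemma cone_rad_pi x r : cone_rad (cone_pi x r) = r%:num.
Proof.
rewrite /cone_rad; have /predU1P[->//|/=] := repr_cone_pi x r.
by case/andP => /eqP -> /eqP ->.
Qed.

Lemma cone_pt_pi xbar x r :
  cone_pt xbar (cone_pi x r) = if r%:num == 0 then xbar else x.
Proof.
rewrite /cone_pt cone_rad_pi; case: ifPn => // r0.
by have /predU1P[->//|/andP[_ /=]] := repr_cone_pi x r; rewrite (negbTE r0).
Qed.

Lemma cone_dist_pi x r y s : cone_dist (cone_pi x r) (cone_pi y s) =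
  Num.sqrt (r%:num ^+ 2 + s%:num ^+ 2 - 2 * r%:num * s%:num * cos (dpi x y)).
Proof.
rewrite /cone_dist !cone_rad_pi /cosine_law; congr (Num.sqrt (_ - _)).
have /predU1P[->|/andP[_ /eqP/= ->]] := repr_cone_pi x r; last first.
  by rewrite mulr0 !mul0r.
have /predU1P[->//|/andP[_ /eqP/= ->]] := repr_cone_pi y s.
by rewrite mulr0 !mul0r.
Qed.

Lemma cone_rad_ge0 p : 0 <= cone_rad p.
Proof. by rewrite /cone_rad. Qed.

Lemma cone_dist_refl p : cone_dist p p = 0.
Proof.
by rewrite /cone_dist dpi_refl /cosine_law cos0 (_ : _ - _ = 0) ?sqrtr0//; ring.
Qed.

Lemma cone_dist_sym p q : cone_dist p q = cone_dist q p.
Proof.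
by rewrite /cone_dist dpi_sym /cosine_law; congr (Num.sqrt _); ring.
Qed.

Lemma cone_dist_triangle p q w :
  cone_dist p w <= cone_dist p q + cone_dist q w.
Proof.
by apply: cosine_law_triangle;
  rewrite ?cone_rad_ge0 ?dpi_ge0 ?dpi_le ?dpi_triangle.
Qed.

Definition cone_ball p (e : R) : set (cone X) := [set q | cone_dist p q < e].

Lemma cone_ball_center p (e : R) : 0 < e -> cone_ball p e p.
Proof. by rewrite /cone_ball/= cone_dist_refl. Qed.

Lemma cone_ball_sym p q (e : R) : cone_ball p e q -> cone_ball q e p.
Proof. by rewrite /cone_ball/= cone_dist_sym. Qed.

Lemma cone_ball_triangle p q w (e1 e2 : R) :
  cone_ball p e1 q -> cone_ball q e2 w -> cone_ball p (e1 + e2) w.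
Proof.
rewrite /cone_ball/= => h1 h2.
by rewrite (le_lt_trans (cone_dist_triangle p q w))// ltrD.
Qed.

Definition cone_ent : set_system (cone X * cone X) := entourage_ cone_ball.

HB.instance Definition _ := hasNbhs.Build (cone X) (nbhs_ cone_ent).
HB.instance Definition _ := @Nbhs_isPseudoMetric.Build R (cone X)
  cone_ent erefl cone_ball cone_ball_center cone_ball_sym cone_ball_triangle
  erefl.
HB.instance Definition _ := isPointed.Build (cone X) (cone_pi point 0%:nng).

End cone_metric.

(* Joins the pointed and the product topological structures. *)
HB.instance Definition _ (T U : ptopologicalType) := Pointed.on (T * U)%type.

Notation borel T := (g_sigma_algebraType (@open T)).

Record radon_measure (R : realType) (T : ptopologicalType) := RadonMeasure {
  radon_val :> {finite_measure set (borel T) -> \bar R} ;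
  radon_inner_regular : forall B : set (borel T), measurable B ->
    forall e : R, 0 < e ->
    exists K : set T, [/\ compact K, K `<=` B & (radon_val (B `\` K) <= e%:E)%E]
}.

Section hellinger_kantorovich.
Context {R : realType} {X : pseudoPMetricType R}.
Local Open Scope ereal_scope.

Definition coneM2 :=
  [set alpha : radon_measure R (cone X * cone X)%type | \int[alpha]_p
     ((cone_rad p.1 ^+ 2 + cone_rad p.2 ^+ 2)%R)%:E < +oo].

(* The set function (x_i)_# (r_i^2 alpha), where [pr] is the projection on the
   i-th component. It does not depend on [xbar] since r_i vanishes wherever
   [xbar] is used. *)
Definition hmarg (xbar : X) (pr : cone X * cone X -> cone X)
    (alpha : radon_measure R (cone X * cone X)%type) (A : set (borel X)) : \bar R :=
  @pushforward _ _ (borel (cone X * cone X)%type) (borel X) R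
    (fun B => \int[alpha]_(p in B) ((cone_rad (pr p) ^+ 2)%R)%:E)
    (cone_pt xbar \o pr) A.

Definition hk_plans (xbar : X) (mu1 mu2 : radon_measure R X) :=
  [set alpha : radon_measure R (cone X * cone X)%type | [/\ coneM2 alpha,
    forall A, measurable A -> hmarg xbar fst alpha A = mu1 A &
    forall A, measurable A -> hmarg xbar snd alpha A = mu2 A]].

(* The infimum is attained for Radon plans; it is written as an infimum so that
   [HK] is a total function. *)
Definition HK (xbar : X) (mu1 mu2 : radon_measure R X) : \bar R :=
  sqrte (ereal_inf [set \int[alpha]_p ((cone_dist p.1 p.2 ^+ 2)%R)%:E
                   | alpha in hk_plans xbar mu1 mu2]).

End hellinger_kantorovich.

Definition complete_for (R : realType) (T : Type) (dist : T -> T -> \bar R) :=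
  forall u : nat -> T,
    (forall e : R, 0 < e ->
       exists N : nat, forall m n : nat, (N <= m)%N -> (N <= n)%N ->
         (dist (u m) (u n) < e%:E)%E) ->
    exists l : T, dist (u n) l @[n --> \oo] --> 0%E.

(* Main.v *)
From HB Require Import structures.
Require Import Defs.
From mathcomp Require Import all_boot all_order all_algebra.
From mathcomp Require Import all_classical all_reals all_analysis.
From mathcomp Require Import measurable_realfun.
From mathcomp Require Import ring lra.

(** Let [u] be a Cauchy sequence and [v k = u (n k)] a subsequence with
    [HK (v k) (v k.+1) < 2^-k]. A measure on [X] is described by a random point
    [[x, r]] of the cone on some measure space, of which it is the homogeneous
    marginal ([realizes]); two random points on a common space give a plan, and
    bound the distance by the integral of the squared cone distance
    ([HK_le_cost]). The idea is to describe all the [v k] by random points on one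
    space such that consecutive ones are close in mean square. These random
    points then converge almost everywhere, since [X], hence the cone, is complete,
    and the homogeneous marginal of the limit is the limit of the sequence.

    To put infinitely many plans on one space, the base points of [v k] are first
    moved to nearby points of a countable dense set, at a cost [4^-k]
    ([small_cost_quantizer]). A plan between measures carried by countably many
    base points is, up to a constant factor in the cost, a matrix of masses
    ([lumped_cost_le]), and following it from a given random point only requires
    to cut regions of the space into pieces of prescribed masses. An atomless
    measure on the line allows this indefinitely ([atomless_split],
    [follow_plan]); mass that a plan creates from the vertex of the cone is put
    on regions set aside for this purpose. This gives [chain_realization], whose
    limit is taken in [realization_limit].

    A term [u i] with [i >= n k] is close to [v k], and a plan between them is
    glued to the [k]-th random point and the limit ([HK_le_glue]). The middle
    measure has countably many base points after quantization, so that the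
    gluing is a product measure on each state, with radii dilated to make the
    two descriptions of the middle measure agree.

    All plans so obtained must be Radon. On [X] this is Ulam's theorem ([ulam]);
    on pairs of cone points it reduces to [X] since a compact set of base points
    together with bounded radii is compact ([cone_tight]). *)

Set Implicit Arguments.
Unset Strict Implicit.
Unset Printing Implicit Defensive.

Import Order.TTheory GRing.Theory Num.Theory.
Import numFieldNormedType.Exports.

Local Open Scope classical_set_scope.
Local Open Scope ring_scope.

(** * Strongly measurable maps *)

Section strong_measurability.
Context {d : measure_display} {W : measurableType d}.

Lemma measurable_fun_nat (n : W -> nat) :
  (forall k, measurable (n @^-1` [set k])) -> measurable_fun setT n.
Proof.
move=> mn _ A _; rewrite setTI.
have -> : n @^-1` A = \bigcup_(k in A) n @^-1` [set k].
  by apply/seteqP; split=> [w Aw|w [k Ak /= ->]//]; exists (n w).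
exact: bigcup_measurable.
Qed.

(** The factorization through [nat] is part of the definition so that a pair of
    such maps is again one, by pairing the indices. *)
Definition countably_valued {T : Type} (f : W -> T) :=
  exists (n : W -> nat) (c : nat -> T), measurable_fun setT n /\ f = c \o n.

Lemma countably_valued_preimage {T : Type} (f : W -> T) (A : set T) :
  countably_valued f -> measurable (f @^-1` A).
Proof.
move=> [n [c [mn ->]]]; rewrite comp_preimage -[X in measurable X]setTI.
exact: mn.
Qed.

Lemma countably_valued_comp {T U : Type} (f : W -> T) (h : T -> U) :
  countably_valued f -> countably_valued (h \o f).
Proof. by move=> [n [c [mn ->]]]; exists n, (h \o c). Qed.

Lemma countably_valued_pair {T U : Type} (f : W -> T) (g : W -> U) :
  countably_valued f -> countably_valued g ->
  countably_valued (fun w => (f w, g w)).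
Proof.
move=> [n [c [mn ->]]] [m [e [mm ->]]].
exists (fun w => pickle (n w, m w)).
exists (fun k => let p := odflt (0, 0)%N (unpickle k) in (c p.1, e p.2)).
split; last by apply/funext => w /=; rewrite pickleK.
apply: measurable_fun_nat => k.
have -> : (fun w => pickle (n w, m w)) @^-1` [set k] =
   \bigcup_i \bigcup_(j in [set j | pickle (i, j) = k])
      (n @^-1` [set i] `&` m @^-1` [set j]).
  apply/seteqP; split=> [w /= <-|w /= [i _ [j /= <- [-> ->]]]//].
  by exists (n w) => //; exists (m w).
apply: bigcup_measurable => i _; apply: bigcup_measurable => j _.
apply: measurableI; rewrite -[X in measurable X]setTI; first exact: mn.
exact: mm.
Qed.

(** A pair of Borel maps into a product space without countable base may fail
    to be Borel, because the Borel sets of the product may outnumber those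
    generated by rectangles. Pointwise limits of countably valued maps are stable
    under pairing, and they are Borel measurable by [strongly_measurable_borel]. *)
Definition strongly_measurable {T : topologicalType} (f : W -> T) :=
  exists2 g : nat -> W -> T, (forall k, countably_valued (g k)) &
    forall w, g ^~ w @ \oo --> f w.

Lemma countably_valued_strongly {T : topologicalType} (f : W -> T) :
  countably_valued f -> strongly_measurable f.
Proof. by move=> cf; exists (fun=> f) => // w; exact: cvg_cst. Qed.

Lemma strongly_measurable_comp {T U : topologicalType} (f : W -> T)
  (h : T -> U) : continuous h -> strongly_measurable f ->
  strongly_measurable (h \o f).
Proof.
move=> ch [g cg gf]; exists (fun k => h \o g k) => [k|w].
  exact: countably_valued_comp.
by apply: (cvg_comp _ _ (gf w)); exact: ch.
Qed.

Lemma strongly_measurable_pair {T U : topologicalType} (f : W -> T)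
  (g : W -> U) : strongly_measurable f -> strongly_measurable g ->
  strongly_measurable (fun w => (f w, g w)).
Proof.
move=> [f' cf ff] [g' cg gg]; exists (fun k w => (f' k w, g' k w)) => [k|w].
  exact: countably_valued_pair.
exact: (cvg_pair (ff w) (gg w)).
Qed.

(** An open set is exhausted by closed sets that catch, with a margin, every
    ball inside it: a sequence converging to a point of [U] is eventually in
    one [C k], and conversely a limit of points of [C k] is in [U]. *)
Lemma open_approx {R : realType} {T : pseudoMetricType R} (U : set T) :
  open U ->
  exists2 C : nat -> set T, (forall k, closed (C k)) & 
   [/\ forall k, C k `<=` U & forall x (e : R), 0 < e -> ball x e `<=` U ->
     exists k, ball x (e / 2) `<=` C k].
Proof.
move=> oU; exists (fun k => closure [set x | ball x k.+1%:R^-1 `<=` U]) => [k|].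
  exact: closed_closure.
split=> [k x clx|x e e0 xU].
  have [|v [/= vU vx]] := clx (ball x k.+1%:R^-1).
    by apply: nbhsx_ballx; rewrite invr_gt0.
  by apply: vU; exact: ball_sym.
have e20 : 0 < e / 2 by rewrite divr_gt0.
have [k ke] : exists k : nat, (k.+1%:R^-1 : R) < e / 2.
  have /= [k _ /(_ k (leqnn k)) kk] := near_infty_natSinv_lt (PosNum e20).
  by exists k.
exists k => y xy; apply: subset_closure => z yz.
apply: xU; rewrite (splitr e); apply: (ball_triangle xy).
by apply: le_ball yz; exact: ltW.
Qed.

Lemma strongly_measurable_preimage {R : realType} {T : pseudoMetricType R}
  (f : W -> T) (U : set T) :
  strongly_measurable f -> open U -> measurable (f @^-1` U).
Proof.
move=> [g cg gf] oU; have [C cC [CU UC]] := open_approx oU.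
have -> : f @^-1` U =
    \bigcup_k \bigcup_N \bigcap_(n in [set n | (N <= n)%N]) g n @^-1` C k.
  apply/seteqP; split => [w /= Uw|w [k _ [N _ wC]]] /=.
    have /nbhs_ballP[e /= e0 fe] : nbhs (f w) U by exact: open_nbhs_nbhs.
    have [k kC] := UC _ _ e0 fe.
    have /gf[N _ NC] : nbhs (f w) (ball (f w) (e / 2)).
      by apply: nbhsx_ballx; rewrite divr_gt0.
    exists k => //; exists N => // n /= Nn; apply: kC; exact: NC.
  apply: (CU k); apply: (closed_cvg (C k) (cC k) _ (f w) (gf w)).
  by exists N => // n /= Nn; exact: wC.
apply: bigcup_measurable => k _; apply: bigcup_measurable => N _.
apply: bigcap_measurable; first by exists N => /=.
move=> n _; exact: countably_valued_preimage.
Qed.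

End strong_measurability.

Section borel_measurability.
Context {R : realType}.

Lemma borel_measurable_fun {d} {W : measurableType d} {T : ptopologicalType}
  (f : W -> borel T) : (forall U : set T, open U -> measurable (f @^-1` U)) ->
  measurable_fun setT f.
Proof.
move=> mf; apply: (@measurability _ _ _ _ setT f (@open T)) => //.
by move=> _ [B oB <-]; rewrite setTI; exact: mf.
Qed.

Lemma strongly_measurable_borel {d} {W : measurableType d}
  {T : pseudoPMetricType R} (f : W -> T) :
  strongly_measurable f -> measurable_fun setT (f : W -> borel T).
Proof.
by move=> sf; apply: borel_measurable_fun => U; exact: strongly_measurable_preimage.
Qed.

Lemma borel_open {T : ptopologicalType} (U : set T) :
  open U -> measurable (U : set (borel T)).
Proof. exact: sub_sigma_algebra. Qed.

Lemma borel_closed {T : ptopologicalType} (U : set T) :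
  closed U -> measurable (U : set (borel T)).
Proof.
by move=> cU; rewrite -[U]setCK; apply: measurableC; apply: borel_open; exact: closed_openC.
Qed.

Lemma continuous_borel {T U : ptopologicalType} (f : T -> U) :
  continuous f -> measurable_fun setT (f : borel T -> borel U).
Proof.
move=> cf; apply: borel_measurable_fun => V oV; apply: borel_open.
by move/continuousP: cf; exact.
Qed.

Lemma separable_seq {T : ptopologicalType} : separable T ->
  exists s : nat -> T, forall U, open U -> U !=set0 -> exists n, U (s n).
Proof.
move=> [S cS dS]; have [x Sx] : S !=set0.
  have [|x [_ Sx]] := dS setT _ openT; first by exists point.
  by exists x.
have /countable_injP[f injf] := cS.
exists (fun n => if pselect (exists2 y, S y & f y = n) is left e then s2val (cid2 e) else x).
move=> U oU U0; have [y [Uy Sy]] := dS U U0 oU.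
exists (f y); case: pselect => [e|]; last by case; exists y.
case: (cid2 e) => z /= Sz fz; suff -> : z = y by [].
by apply: injf; rewrite ?inE.
Qed.

(** Choosing the least admissible index is a measurable selection. *)
Lemma first_index {d} {W : measurableType d} (A : nat -> set W) :
  (forall n, measurable (A n)) -> (forall w, exists n, A n w) ->
  exists2 f : W -> nat, measurable_fun setT f &
    forall w, A (f w) w /\ forall i, (i < f w)%N -> ~ A i w.
Proof.
move=> mA cA.
have ex w : exists n, `[< A n w >] by have [n] := cA w; exists n; exact/asboolP.
exists (fun w => ex_minn (ex w)); last first.
  move=> w; case: ex_minnP => n /asboolP An nmin; split=> // i ilt Ai.
  by have := nmin i; rewrite leqNgt ilt => /(_ (introT (asboolP _) Ai)).
apply: measurable_fun_nat => k.
have -> : (fun w => ex_minn (ex w)) @^-1` [set k] =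
    A k `\` \bigcup_(i in `I_k) A i.
  apply/seteqP; split=> [w /=|w /= [Ak nA]].
    case: ex_minnP => n /asboolP An nmin nk; subst n; split=> // -[i /= ik Ai].
    by have := nmin i; rewrite leqNgt ik => /(_ (introT (asboolP _) Ai)).
  case: ex_minnP => n /asboolP An nmin; apply/eqP; rewrite eqn_leq.
  rewrite nmin; last exact/asboolP.
  by rewrite leqNgt; apply/negP => nk; apply: nA; exists n.
apply: measurableD => //; apply: bigcup_measurable => //.
Qed.

(** In a separable space every point is near one of the points [s i] of a dense
    sequence; sending a point to the first good [s i] approximates the
    identity. *)
Lemma borel_strongly_measurable {d} {W : measurableType d}
  {T : pseudoPMetricType R} (f : W -> T) : separable T ->
  measurable_fun setT (f : W -> borel T) -> strongly_measurable f.
Proof.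
move=> /separable_seq[s ds] mf.
have /choice[n nP] k : exists n : W -> nat, measurable_fun setT n /\
    forall w, ball (s (n w)) k.+1%:R^-1 (f w).
  (* interiors, as balls are not assumed to be open *)
  have [||n mn nP] := @first_index _ W
    (fun i => f @^-1` (ball (s i) k.+1%:R^-1)°).
  - move=> i; rewrite -[X in measurable X]setTI; apply: mf => //.
    by apply: borel_open; exact: open_interior.
  - move=> w; have [||i si] := ds (ball (f w) (k.+1%:R^-1 / 2))°.
    + exact: open_interior.
    + by exists (f w); apply: nbhsx_ballx; rewrite divr_gt0.
    exists i => /=; apply/nbhs_ballP; exists (k.+1%:R^-1 / 2) => /=.
      by rewrite divr_gt0.
    move=> y fy; rewrite (splitr k.+1%:R^-1); apply: ball_triangle fy.
    by apply: ball_sym; exact: interior_subset si.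
  exists n; split=> // w; have [+ _] := nP w; exact: interior_subset.
exists (fun k => s \o n k) => [k|w]; first by exists (n k), s; have [] := nP k.
apply/cvg_ballP => e e0.
near=> k; apply: ball_sym; apply: (@le_ball _ _ _ k.+1%:R^-1).
  by apply/ltW; near: k; exact: (near_infty_natSinv_lt (PosNum e0)).
by have [_ /(_ w)] := nP k.
Unshelve. all: by end_near. Qed.

End borel_measurability.

(** * Finite Borel measures are Radon *)

Section radonness.
Context {R : realType}.
Local Open Scope ereal_scope.

Lemma measure_subU_le {d} {W : measurableType d} (mu : {measure set W -> \bar R})
  (A B C : set W) : measurable A -> measurable B -> measurable C ->
  A `<=` B `|` C -> mu A <= mu B + mu C.
Proof.
move=> mA mB mC ABC; apply: le_trans (measureU2 _ mB mC).
by apply: le_measure; rewrite ?inE//; exact: measurableU.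
Qed.

Lemma nonincreasing_mu_lt {d} {W : measurableType d}
  (mu : {finite_measure set W -> \bar R}) (F : (set W)^nat) (c : \bar R) :
  (forall n, measurable (F n)) -> nonincreasing_seq F ->
  mu (\bigcap_n F n) < c -> exists n, mu (F n) < c.
Proof.
move=> mF dF Fc.
have cv : mu \o F @ \oo --> mu (\bigcap_n F n).
  apply: nonincreasing_cvg_mu => //; first by rewrite ltey_eq fin_num_measure.
  exact: bigcap_measurableType.
have /cv[n _ /(_ n (leqnn n)) ?] : nbhs (mu (\bigcap_n F n)) [set y | y < c].
  by apply: open_nbhs_nbhs; split => //; exact: open_ereal_lt_ereal.
by exists n.
Qed.

(** The sets approximable in measure by closed sets from inside and by open
    sets from outside form a sigma-algebra, which contains the open sets because
    these are countable unions of closed sets. *)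
Lemma closed_inner_regular {T : pseudoPMetricType R}
  (mu : {finite_measure set (borel T) -> \bar R}) (B : set (borel T)) (e : R) :
  measurable B -> (0 < e)%R ->
  exists2 F : set T, closed F & F `<=` B /\ mu (B `\` F) <= e%:E.
Proof.
move=> mB.
pose reg (B : set T) := forall e : R, (0 < e)%R -> exists F U : set T,
  [/\ closed F, open U, F `<=` B, B `<=` U & mu (U `\` F) <= e%:E].
suff rB : reg B.
  move=> /rB[F [U [cF oU FB BU UF]]]; exists F => //; split=> //.
  apply: le_trans UF; apply: le_measure; rewrite ?inE.
  - by apply: measurableD => //; exact: borel_closed.
  - by apply: measurableD; [exact: borel_open|exact: borel_closed].
  - exact: setSD.
apply: (@smallest_sub _ (sigma_algebra setT) (@open T) reg _ _ B mB); last first.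
  move=> U oU {}e e0; have [C cC [CU UC]] := open_approx oU.
  pose F n := U `\` \big[setU/set0]_(i < n) C i.
  have cCn n : closed (\big[setU/set0]_(i < n) C i).
    by elim/big_ind : _ => [|? ? ? ?|//]; [exact: closed0|exact: closedU].
  have [| | |n Fn] := @nonincreasing_mu_lt _ _ mu F e%:E.
  - by move=> n; apply: measurableD; [exact: borel_open|exact: borel_closed].
  - by move=> n m nm; apply/subsetPset; apply: setDS => x; exact: subset_bigsetU.
  - rewrite (_ : \bigcap_n F n = set0) ?measure0 ?lte_fin//.
    rewrite -subset0 => x Fx; have [Ux _] := Fx 0%N I.
    have /nbhs_ballP[r /= r0 xr] : nbhs x U by exact: open_nbhs_nbhs.
    have [k kC] := UC _ _ r0 xr.
    have [_] := Fx k.+1 I; apply; rewrite big_ord_recr/=; right.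
    by apply: kC; apply: ballxx; rewrite divr_gt0.
  - exists (\big[setU/set0]_(i < n) C i), U; split=> //; last exact: ltW.
    by elim/big_ind : _ => [//|? ? ? ?|i _]; [rewrite subUset|exact: CU].
split.
- by move=> {}e e0; exists set0, set0; split; rewrite ?setD0 ?measure0 ?lee_fin ?ltW//;
    [exact: closed0|exact: open0].
- move=> A rA {}e e0; have [F [U [cF oU FA AU UF]]] := rA e e0.
  exists (~` U), (~` F); rewrite setTD; split; rewrite ?closedC ?openC//.
  + exact: subsetC.
  + exact: subsetC.
  + by rewrite setDE setCK setIC -setDE.
- move=> A rA {}e e0; pose f n : R := (e / 2 / (2 ^ n.+1)%:R)%R.
  have f0 n : (0 < f n)%R by rewrite !divr_gt0// ltr0n expn_gt0.
  have /choice[F /choice[U FU]] n : exists F, exists U, 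
      [/\ closed F, open U, F `<=` A n, A n `<=` U & mu (U `\` F) <= (f n)%:E].
    by have [F [U ?]] := rA n _ (f0 n); exists F, U.
  have mU n : measurable (U n : set (borel T)) by have [_ oU _ _ _] := FU n; exact: borel_open.
  have mF n : measurable (F n : set (borel T)) by have [cF _ _ _ _] := FU n; exact: borel_closed.
  pose V := \bigcup_n U n.
  have mV : measurable (V : set (borel T)) by exact: bigcup_measurable.
  have cFn n : closed (\big[setU/set0]_(i < n) F i).
    elim/big_ind : _ => [|? ? ? ?|i _]; [exact: closed0|exact: closedU|].
    by have [] := FU i.
  pose G n := V `\` \big[setU/set0]_(i < n) F i.
  have [| | |n Gn] := @nonincreasing_mu_lt _ _ mu G e%:E.
  + by move=> n; apply: measurableD => //; exact: borel_closed.
  + by move=> n m nm; apply/subsetPset; apply: setDS => x; exact: subset_bigsetU.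
  + apply: (@le_lt_trans _ _ (\sum_(n <oo) mu (U n `\` F n))).
      apply: measure_sigma_subadditive => //.
      * by move=> n; exact: measurableD.
      * apply: bigcap_measurableType => n _; apply: measurableD => //.
        exact: borel_closed.
      * move=> x Gx; have [[k _ Ukx] _] := Gx 0%N I.
        exists k => //; split=> // Fkx; have [_] := Gx k.+1 I; apply.
        by rewrite big_ord_recr/=; right.
    apply: (@le_lt_trans _ _ (\sum_(n <oo) (f n)%:E)).
      by apply: lee_nneseries => // n _; have [] := FU n.
    apply: le_lt_trans (epsilon_trick0 _ _) _ => //.
      by rewrite ltW// divr_gt0.
    by rewrite lte_fin; lra.
  + exists (\big[setU/set0]_(i < n) F i), V; split=> //; last exact: ltW.
    * by apply: bigcup_open => k _; have [] := FU k.
    * elim/big_ind : _ => [//|? ? ? ?|i _]; [by rewrite subUset|].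
      by move=> x Fx; exists i => //; have [_ _ + _ _] := FU i; exact.
    * by move=> x [k _ Ax]; exists k => //; have [_ _ _ + _] := FU k; exact.
Qed.

Definition tight {T : ptopologicalType} (mu : set (borel T) -> \bar R) :=
  forall e : R, (0 < e)%R -> exists K : set T,
    [/\ compact K, measurable (K : set (borel T)) & mu (~` K) <= e%:E].

(** A compact set carrying almost all the mass is intersected with a closed
    approximation of [B] from inside. *)
Lemma tight_inner_regular {T : pseudoPMetricType R}
  (mu : {finite_measure set (borel T) -> \bar R}) : tight mu ->
  forall B : set (borel T), measurable B -> forall e : R, (0 < e)%R ->
    exists K : set T, [/\ compact K, K `<=` B & mu (B `\` K) <= e%:E].
Proof.
move=> tmu B mB e e0; have e20 : (0 < e / 2)%R by rewrite divr_gt0.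
have [K [cK mK Ke]] := tmu _ e20.
have [F cF [FB Fe]] := closed_inner_regular mu mB e20.
have mF := borel_closed cF.
exists (K `&` F); split; first exact: compact_closedI.
  by move=> x [_ /FB].
rewrite [e]splitr EFinD; apply: le_trans (leeD Ke Fe).
apply: measure_subU_le.
- by apply: measurableD => //; exact: measurableI.
- exact: measurableC.
- exact: measurableD.
- move=> x [Bx KFx]; have [Kx|] := pselect (K x); last by left.
  by right; split => // Fx; exact: KFx.
Qed.

(** Ulam's theorem. For each radius finitely many balls carry all the mass up to
    a summable error; the intersection of these finite unions is closed and
    totally bounded, so an ultrafilter on it is Cauchy and converges. *)
Lemma ulam {X : completePseudoMetricType R}
  (mu : {finite_measure set (borel X) -> \bar R}) : separable X -> tight mu.
Proof.
move=> /separable_seq[s ds] e e0.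
pose f k : R := (e / (2 ^ k.+1)%:R)%R.
have f0 n : (0 < f n)%R by rewrite !divr_gt0// ltr0n expn_gt0.
pose C k n : set X := closure (ball (s n) k.+1%:R^-1%R).
have cC k n : closed (\big[setU/set0]_(i < n) C k i).
  elim/big_ind : _ => [|? ? ? ?|i _]; [exact: closed0|exact: closedU|].
  exact: closed_closure.
have /choice[N NP] k : exists n, mu (~` \big[setU/set0]_(i < n) C k i) < (f k)%:E.
  apply: nonincreasing_mu_lt.
  - by move=> n; apply: measurableC; exact: borel_closed.
  - by move=> n m nm; apply/subsetPset; apply: subsetC => x; exact: subset_bigsetU.
  - rewrite (_ : \bigcap__ _ = set0) ?measure0 ?lte_fin//.
    rewrite -subset0 => x Cx; have [||i si] := ds (ball x (k.+1%:R^-1))°%R.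
    + exact: open_interior.
    + by exists x; apply: nbhsx_ballx; rewrite invr_gt0.
    apply: (Cx i.+1 I); rewrite big_ord_recr/=; right.
    by apply: subset_closure; apply: ball_sym; exact: interior_subset si.
pose K := \bigcap_k \big[setU/set0]_(i < N k) C k i.
have clK : closed K by apply: closed_bigI => k _; exact: cC.
exists K; split; last 2 first.
- exact: borel_closed.
- rewrite setC_bigcap.
  apply: (@le_trans _ _ (\sum_(k <oo) mu (~` \big[setU/set0]_(i < N k) C k i))).
    apply: measure_sigma_subadditive => //.
    + by move=> k; apply: measurableC; exact: borel_closed.
    + apply: bigcup_measurable => k _; apply: measurableC; exact: borel_closed.
  apply: (@le_trans _ _ (\sum_(n <oo) (f n)%:E)).
    by apply: lee_nneseries => // n _; rewrite ltW.
  by apply: epsilon_trick0; exact: ltW.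
rewrite compact_ultra => G UG GK.
suff /cauchy_cvgP/cvg_ex[x Gx] : cauchy G.
  exists x; split => //; exact: (closed_cvg _ clK _ _ Gx).
apply: cauchy_exP => r r0.
have r20 : (0 < r / 2)%R by rewrite divr_gt0.
have [k ke] : exists k : nat, (k.+1%:R^-1 < r / 2)%R.
  have /= [k _ /(_ k (leqnn k)) kk] := near_infty_natSinv_lt (PosNum r20).
  by exists k.
have [i Gi] : exists i, G (C k i).
  have : G (\big[setU/set0]_(i < N k) C k i).
    by apply: filterS GK => x; exact.
  elim: (N k) => [|n IH].
    by rewrite big_ord0 => /filter_ex[].
  rewrite big_ord_recr/= => Gn.
  have [Gc|Gc] := in_ultra_setVsetC (C k n) UG; first by exists n.
  apply: IH; apply: filterS (filterI Gn Gc) => x [[//|]].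
  by [].
exists (s i); apply: filterS Gi => x Cx.
have [|y [/= sy xy]] := Cx (ball x (r / 2)); first exact: nbhsx_ballx.
rewrite (splitr r); apply: (@ball_triangle _ _ y).
  by apply: le_ball sy; exact: ltW.
exact: ball_sym.
Qed.

End radonness.

(** * The cost on the cone and the topology of the cone *)

Section continuous_distances.
Context {R : realType}.

Lemma continuous_dist {T : pseudoMetricType R} (rho : T -> T -> R) :
  (forall x y, rho x y = rho y x) ->
  (forall x y z, rho x z <= rho x y + rho y z) ->
  (forall x y (e : R), 0 < e -> ball x e y -> rho x y <= e) ->
  continuous (fun p : T * T => rho p.1 p.2).
Proof.
move=> rhoC rhoD rho_ball [x y]; apply/cvg_ballP => e e0.
have e30 : 0 < e / 3 by rewrite divr_gt0.
apply: filterS (nbhsx_ballx (x, y) _ e30) => -[x' y'] [/= xx' yy'].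
have {}xx' := rho_ball _ _ _ e30 xx'; have {}yy' := rho_ball _ _ _ e30 yy'.
rewrite /ball/= ltr_norml; apply/andP; split.
  have := rhoD x' x y'; have := rhoD x y y'; rewrite (rhoC x' x); lra.
have := rhoD x x' y; have := rhoD x' y' y; rewrite (rhoC y' y); lra.
Qed.

Lemma open_ball_ex {T : pseudoMetricType R} (A : set T) :
  (forall x, A x -> exists2 e : R, 0 < e & ball x e `<=` A) -> open A.
Proof.
by move=> bA; rewrite openE => x /bA[e e0 eA]; apply/nbhs_ballP; exists e.
Qed.

Lemma continuous_lipschitz {T : pseudoMetricType R} (f : T -> R) :
  (forall x y (e : R), 0 < e -> ball x e y -> `|f x - f y| < e) -> continuous f.
Proof.
move=> fl x; apply/cvg_ballP => e e0; apply: filterS (nbhsx_ballx x _ e0) => y.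
exact: fl.
Qed.

Context {X : pseudoMetricType R}.
Implicit Types (x y z : X) (r s t : R).

Lemma dpi_ball (x y : X) (e : R) : 0 < e -> ball x e y -> dpi x y <= e.
Proof.
by move=> e0 xy; rewrite -lee_fin dpiE ge_min edist_fin.
Qed.

Lemma ball_dpi (x y : X) (e : R) : e <= pi -> dpi x y < e -> ball x e y.
Proof.
move=> epi; rewrite -lte_fin dpiE gt_min => /orP[/edist_lt_ball//|].
by rewrite lte_fin ltNge epi.
Qed.

Lemma continuous_dpi : continuous (fun p : X * X => dpi p.1 p.2).
Proof.
by apply: continuous_dist; [exact: dpi_sym|exact: dpi_triangle|exact: dpi_ball].
Qed.

(** The squared cone distance in polar coordinates; pairs [(x, r)] are easier to
    handle than their classes, which matter only for the topology. *)
Definition cone_cost (x : X) (r : R) (y : X) (s : R) := cosine_law r s (dpi x y).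

Lemma cone_costE x r y s :
  cone_cost x r y s = (r - s) ^+ 2 + 2 * r * s * (1 - cos (dpi x y)).
Proof. by rewrite /cone_cost /cosine_law; ring. Qed.

Lemma cone_cost_ge0 x r y s : 0 <= cone_cost x r y s.
Proof. exact: cosine_law_ge0. Qed.

Lemma cone_costC x r y s : cone_cost x r y s = cone_cost y s x r.
Proof. by rewrite !cone_costE dpi_sym; ring. Qed.

Lemma cone_cost_refl x r : cone_cost x r x r = 0.
Proof. by rewrite cone_costE dpi_refl cos0; ring. Qed.

Lemma cone_cost0 x r y : cone_cost x r y 0 = r ^+ 2.
Proof. by rewrite cone_costE; ring. Qed.

Lemma cone_costZ x r y s (t : R) :
  cone_cost x (t * r) y (t * s) = t ^+ 2 * cone_cost x r y s.
Proof. by rewrite !cone_costE; ring. Qed.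

(** The triangle inequality of the distance, squared with [(b + c)^2 <= 2 (b^2 + c^2)]. *)
Lemma cone_cost_triangle x r y s z t : 0 <= r -> 0 <= s -> 0 <= t ->
  cone_cost x r z t <= 2 * (cone_cost x r y s + cone_cost y s z t).
Proof.
move=> r0 s0 t0.
have dd (a b : X) : 0 <= dpi a b <= pi by rewrite dpi_ge0 dpi_le.
have := cosine_law_triangle r0 s0 t0 (dd x y) (dd y z) (dd x z) (dpi_triangle x y z).
rewrite -!/(cone_cost _ _ _ _) => h.
have := sqr_sqrtr (cone_cost_ge0 x r z t).
have := sqr_sqrtr (cone_cost_ge0 x r y s).
have := sqr_sqrtr (cone_cost_ge0 y s z t).
have := sqrtr_ge0 (cone_cost x r z t).
have := sqrtr_ge0 (cone_cost x r y s).
have := sqrtr_ge0 (cone_cost y s z t).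
move: h; move: (Num.sqrt _) (Num.sqrt _) (Num.sqrt _) => c b a abc c0 b0 a0 <- <- <-.
have : a ^+ 2 <= (b + c) ^+ 2 by rewrite ler_sqr ?nnegrE ?addr_ge0.
by have := sqr_ge0 (b - c); rewrite !sqrrD sqrrN; lra.
Qed.

Lemma cone_cost_rad x r y s : 0 <= r -> 0 <= s -> (r - s) ^+ 2 <= cone_cost x r y s.
Proof.
move=> r0 s0; rewrite cone_costE lerDl !mulr_ge0 ?subr_ge0 ?cos_le1//.

Qed.

Lemma cone_cost_le x r y s : 0 <= r -> 0 <= s ->
  cone_cost x r y s <= 2 * (r ^+ 2 + s ^+ 2).
Proof.
move=> r0 s0; rewrite /cone_cost /cosine_law.
have := cos_geN1 (dpi x y); have := cos_le1 (dpi x y).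
have : 0 <= r * s by rewrite mulr_ge0.
have := sqr_ge0 (r - s); rewrite sqrrB; nra.
Qed.

Lemma cvg_cone_cost {I : Type} {F : set_system I} {FF : Filter F}
  (x : I -> X) (r : I -> R) (y : I -> X) (s : I -> R) x' r' y' s' :
  x @ F --> x' -> r @ F --> r' -> y @ F --> y' -> s @ F --> s' ->
  cone_cost (x i) (r i) (y i) (s i) @[i --> F] --> cone_cost x' r' y' s'.
Proof.
move=> xx rr yy ss; rewrite /cone_cost /cosine_law.
have dd : dpi (x i) (y i) @[i --> F] --> dpi x' y'.
  have xy : (x i, y i) @[i --> F] --> (x', y') by exact: cvg_pair.
  have cd := continuous_dpi; exact: (cvg_comp _ _ xy (cd (x', y'))).
have cc : cos (dpi (x i) (y i)) @[i --> F] --> cos (dpi x' y').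
  by apply: (cvg_comp _ _ dd); exact: continuous_cos.
apply: cvgB; last by apply: cvgM cc; apply: cvgM ss; apply: cvgM rr; exact: cvg_cst.
apply: cvgD; rewrite !expr2; first exact: cvgM.
exact: cvgM.
Qed.

End continuous_distances.

Section cone_topology.
Context {R : realType} {X : pseudoPMetricType R}.
Implicit Types (p q : cone X).

(** The absolute value makes the projection onto the cone total on [X * R],
    where continuity can be stated in the product topology. *)
Definition conept (u : X * R) : cone X := cone_pi u.1 `|u.2|%:nng.

Lemma cone_rad_conept x r : 0 <= r -> cone_rad (conept (x, r)) = r.
Proof. by move=> r0; rewrite /conept cone_rad_pi/= ger0_norm. Qed.

Lemma cone_pt_conept xbar x r : 0 <= r -> r != 0 -> cone_pt xbar (conept (x, r)) = x.
Proof.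
by move=> r0 rn0; rewrite /conept cone_pt_pi/= ger0_norm// (negbTE rn0).
Qed.

Lemma cone_dist_conept x r y s : 0 <= r -> 0 <= s ->
  cone_dist (conept (x, r)) (conept (y, s)) = Num.sqrt (cone_cost x r y s).
Proof. by move=> r0 s0; rewrite /conept cone_dist_pi/= !ger0_norm. Qed.

Lemma coneptK xbar p : conept (cone_pt xbar p, cone_rad p) = p.
Proof.
rewrite /conept /cone_pi -[RHS]reprK; apply/eqmodP => /=.
rewrite /= /cone_rel /cone_pt /cone_rad; case: ifPn => [/eqP r0|r0] /=.
  by apply/orP; right; apply/andP; split; apply/eqP => //=; rewrite r0 normr0.
apply/orP; left; case: (repr p) => x r /=; apply/eqP; congr pair.
by apply/val_inj => /=; rewrite ger0_norm.
Qed.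

Lemma conept0 x y : conept (x, 0) = conept (y, 0).
Proof.
rewrite /conept /cone_pi; apply/eqmodP; rewrite /= /cone_rel/=.
by apply/orP; right; apply/andP; split; rewrite normr_eq0.
Qed.

Lemma cone_dist_sqr xbar p q : cone_dist p q ^+ 2 =
  cone_cost (cone_pt xbar p) (cone_rad p) (cone_pt xbar q) (cone_rad q).
Proof.
rewrite -{1}(coneptK xbar p) -{1}(coneptK xbar q).
by rewrite cone_dist_conept ?cone_rad_ge0// sqr_sqrtr// cone_cost_ge0.
Qed.

Lemma continuous_conept : continuous conept.
Proof.
move=> [x r]; apply/cvg_ballP => e e0.
have : cone_dist (conept (x, r)) (conept u) @[u --> (x, r)] --> (0 : R).
  have -> : (fun u => cone_dist (conept (x, r)) (conept u)) =
    fun u => Num.sqrt (cone_cost x `|r| u.1 `|u.2|).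
    by apply/funext => -[y s]; rewrite /conept cone_dist_pi.
  rewrite -[X in _ --> X]sqrtr0 -(cone_cost_refl x `|r|).
  apply: (@cvg_comp _ _ _ _ Num.sqrt); last exact: sqrt_continuous.
  apply: cvg_cone_cost; [exact: cvg_cst|exact: cvg_cst|exact: cvg_fst|].
  by apply: cvg_norm; exact: cvg_snd.
move/cvgr_lt => /(_ _ e0); exact.
Qed.

Lemma cone_rad_dist p q : `|cone_rad p - cone_rad q| <= cone_dist p q.
Proof.
rewrite -[leLHS]sqrtr_sqr -(ger0_norm (sqrtr_ge0 _ : 0 <= cone_dist p q)).
rewrite -[leRHS]sqrtr_sqr ler_sqrt ?sqr_ge0// (cone_dist_sqr point).
by apply: cone_cost_rad; exact: cone_rad_ge0.
Qed.

Lemma continuous_cone_dist : continuous (fun u : cone X * cone X => cone_dist u.1 u.2).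
Proof.
apply: continuous_dist; [exact: cone_dist_sym|exact: cone_dist_triangle|].
by move=> p q e e0 /ltW.
Qed.

Lemma continuous_cone_rad : continuous (@cone_rad R X).
Proof.
apply: continuous_lipschitz => p q e _ pq.
exact: le_lt_trans (cone_rad_dist p q) pq.
Qed.

(** The cosine is strictly decreasing on [0, pi], so a small [1 - cos t]
    forces a small [t]. *)
Lemma cos_small (e : R) : 0 < e -> exists2 c : R, 0 < c &
  forall t, 0 <= t <= pi -> 1 - cos t < c -> t < e.
Proof.
move=> e0; have [epi|pie] := leP e pi; last first.
  by exists 1 => // t /andP[_ tpi] _; exact: le_lt_trans pie.
exists (1 - cos e).
  rewrite subr_gt0 -[X in _ < X]cos0 ltr_cos// in_itv/= ?lexx ?pi_ge0//.
  by rewrite (ltW e0) epi.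
move=> t /andP[t0 tpi]; rewrite ltrD2l ltrN2 ltr_cos// in_itv/= ?t0//.
by rewrite (ltW e0) epi.
Qed.

(** Away from the vertex the base point depends continuously on the point of the
    cone: at radius [r > 0], the term [2 r s (1 - cos d)] of the cost controls
    the distance [d] of the base points. *)
Lemma cone_pt_open xbar (U : set X) : open U ->
  open [set p | 0 < cone_rad p /\ U (cone_pt xbar p)].
Proof.
move=> oU; apply: open_ball_ex => p [p0 Up].
have /nbhs_ballP[e /= e0 eU] : nbhs (cone_pt xbar p) U by exact: open_nbhs_nbhs.
have e'0 : 0 < Num.min e pi by rewrite lt_min e0 pi_gt0.
have [c c0 cP] := cos_small e'0.
have rp0 : 0 < cone_rad p / 2 by rewrite divr_gt0.
have dp0 : 0 < Num.sqrt (c * cone_rad p ^+ 2).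
  by rewrite sqrtr_gt0 mulr_gt0// exprn_gt0.
(* the first bound keeps the radius above half of [cone_rad p] *)
exists (Num.min (cone_rad p / 2) (Num.sqrt (c * cone_rad p ^+ 2))).
  by rewrite lt_min rp0.
move=> q; rewrite /ball/= /cone_ball/= lt_min => /andP[q1 q2].
have := le_lt_trans (cone_rad_dist p q) q1; rewrite ltr_norml => /andP[q3 q4].
have rq : cone_rad p / 2 < cone_rad q by lra.
split; first exact: lt_trans rq.
apply: eU; apply: (@le_ball _ _ _ (Num.min e pi)).
  by rewrite ge_min lexx.
apply: ball_dpi; first by rewrite ge_min lexx orbT.
apply: cP; first by rewrite dpi_ge0 dpi_le.
have : cone_dist p q ^+ 2 < c * cone_rad p ^+ 2.
  rewrite -(@sqr_sqrtr _ (c * _)) ?ltr_pXn2r ?nnegrE ?sqrtr_ge0//.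
  by rewrite mulr_ge0 ?ltW// exprn_gt0.
rewrite (cone_dist_sqr xbar) cone_costE.
set t := cos _; have t1 : 0 <= 1 - t by rewrite subr_ge0 cos_le1.
have := sqr_ge0 (cone_rad p - cone_rad q).
move=> h1 h2; rewrite -(ltr_pM2r (exprn_gt0 2 p0)).
apply: le_lt_trans h2; apply: le_trans (_ : _ <= 2 * cone_rad p * cone_rad q * (1 - t)) _.
  rewrite [leLHS]mulrC ler_wpM2r//; nra.
by rewrite lerDr.
Qed.

Lemma measurable_cone_rad : measurable_fun setT (@cone_rad R X : borel (cone X) -> R).
Proof.
apply: (measurability _ (RGenOpens.measurableE R)).
move=> _ [_ [a [b ->]] <-]; rewrite setTI; apply: borel_open.
by move/continuousP: continuous_cone_rad; apply; exact: interval_open.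
Qed.

Lemma measurable_cone_pt xbar :
  measurable_fun setT (cone_pt xbar : borel (cone X) -> borel X).
Proof.
apply: borel_measurable_fun => U oU.
have -> : cone_pt xbar @^-1` U = [set p | 0 < cone_rad p /\ U (cone_pt xbar p)] `|`
   ((@cone_rad R X) @^-1` [set 0] `&` [set p : cone X | U xbar]).
  apply/seteqP; split=> p /=.
    have [p0 pU|p0] := eqVneq (cone_rad p) 0.
      by right; split=> //; move: pU; rewrite /cone_pt p0 eqxx.
    by left; split=> //; rewrite lt_def p0 cone_rad_ge0.
  by case=> [[]//|[p0]]; rewrite /cone_pt p0 eqxx.
apply: measurableU; first by apply: borel_open; exact: cone_pt_open.
apply: measurableI.
  rewrite -[X in measurable X]setTI; exact: measurable_cone_rad.
by have [Ux|nUx] := pselect (U xbar); [rewrite (_ : mkset _ = setT)|rewrite (_ : mkset _ = set0)] => //;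
  apply/seteqP; split.
Qed.

End cone_topology.

(** * Image measures and densities *)

Section finite_images.
Context {R : realType} {d : measure_display} {W : measurableType d}.
Local Open Scope ereal_scope.

Lemma finite_measure_of (m : {measure set W -> \bar R}) : m setT < +oo ->
  exists mu : {finite_measure set W -> \bar R}, forall A, mu A = m A.
Proof.
move=> mT; exists (mfrestr measurableT mT) => A.
by rewrite /= /mfrestr /mrestr setIT.
Qed.

Lemma finite_pushforward {d'} {T : measurableType d'}
  (m : {finite_measure set W -> \bar R}) (f : W -> T) : measurable_fun setT f ->
  exists2 mu : {finite_measure set T -> \bar R},
    forall A, mu A = m (f @^-1` A) &
    forall (g : T -> \bar R) (A : set T), measurable A -> measurable_fun setT g ->
      (forall x, 0 <= g x) -> \int[mu]_(x in A) g x = \int[m]_(w in f @^-1` A) g (f w).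
Proof.
move=> mf.
pose mf_mixin := isMeasurableFun.Build _ _ _ _ _ mf.
pose F : {mfun W >-> T} := HB.pack f mf_mixin.
have [H HE] : exists H : {measure set T -> \bar R}, (H : set T -> \bar R) = pushforward m F.
  pose G : {measure set T -> \bar R} := pushforward m F.
  by exists (G mf).
have HT : H setT < +oo by rewrite HE /pushforward preimage_setT ltey_eq fin_num_measure.
exists (mfrestr measurableT HT) => [A|g A mA mg g0].
  by rewrite /= /mfrestr /mrestr /= setIT HE.
rewrite (eq_measure_integral H); last first.
  by move=> B mB BA; rewrite /= /mfrestr /mrestr setIT.
rewrite HE ge0_integral_pushforward//.
exact: measurable_funTS.
Qed.

End finite_images.

Section density.
Context {R : realType} {d : measure_display} {W : measurableType d}.
Local Open Scope ereal_scope.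
Variables (m : {measure set W -> \bar R}) (h : W -> \bar R).
Hypotheses (mh : measurable_fun setT h) (h0 : forall w, 0 <= h w).

Definition density (A : set W) := \int[m]_(w in A) h w.

Let density0 : density set0 = 0. Proof. exact: integral_set0. Qed.

Let density_ge0 A : 0 <= density A.
Proof. by apply: integral_ge0. Qed.

Let density_sigma_additive : semi_sigma_additive density.
Proof.
move=> F mF tF mUF; rewrite /density ge0_integral_bigcup//.
- apply: is_cvg_ereal_nneg_natsum_cond => n _ _.
  exact: integral_ge0.
- exact: measurable_funTS.
Qed.

HB.instance Definition _ := isMeasure.Build _ _ _ density
  density0 density_ge0 density_sigma_additive.

Lemma finite_density : \int[m]_w h w < +oo ->
  exists mu : {finite_measure set W -> \bar R},
    forall A, mu A = \int[m]_(w in A) h w.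
Proof. by move=> hoo; exact: (@finite_measure_of _ _ _ density). Qed.

End density.

(** * Plans given by maps into the cone *)

HB.instance Definition _ (R : realType) (T U : pseudoPMetricType R) :=
  Pointed.on (T * U)%type.

Section cone_plans.
Context {R : realType} {X : completePseudoMetricType R}.
Hypothesis sepX : separable X.
Local Open Scope ereal_scope.

(** The image of a compact set times a bounded interval of radii is compact in
    the cone. Hence tightness on the cone follows from Ulam's theorem for the
    law of the base point and from the finiteness of the radius. *)
Lemma cone_tight_preimage {d} {W : measurableType d} (xbar : X)
  (mu : {finite_measure set W -> \bar R}) (p : W -> borel (cone X)) (e : R) :
  measurable_fun setT p -> (0 < e)%R ->
  exists K : set (cone X), [/\ compact K, measurable (K : set (borel (cone X))) &
    mu (p @^-1` ~` K) <= e%:E].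
Proof.
move=> mp e0; have e20 : (0 < e / 2)%R by rewrite divr_gt0.
have mrp : measurable_fun setT (@cone_rad R X \o p).
  by apply: measurableT_comp mp; exact: measurable_cone_rad.
have mxp : measurable_fun setT (cone_pt xbar \o p : W -> borel X).
  by apply: measurableT_comp mp; exact: measurable_cone_pt.
have [nu nuE _] := finite_pushforward mu mxp.
have [K [cK mK Ke]] := ulam nu sepX e20.
rewrite nuE in Ke.
have mM n : measurable [set w | (n%:R < cone_rad (p w))%R].
  rewrite [X in measurable X](_ : _ = (@cone_rad R X \o p) @^-1` `]n%:R, +oo[).
    by rewrite -[X in measurable X]setTI; exact: mrp.
  by apply/seteqP; split=> w /=; rewrite in_itv/= andbT.
have [//| | |n Mn] := @nonincreasing_mu_lt _ _ _ mu (fun n => [set w | (n%:R < cone_rad (p w))%R]) (e / 2)%:E.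
- move=> i j ij; apply/subsetPset => w /=; apply: le_lt_trans.
  by rewrite ler_nat.
- rewrite (_ : \bigcap__ _ = set0) ?measure0 ?lte_fin//.
  rewrite -subset0 => w Cw; have := Cw (Num.truncn (cone_rad (p w))).+1 I.
  rewrite /= ltNge => /negP; apply.
  by rewrite ltW// truncnS_gt.
(* the vertex has base point [xbar], which need not be in [K] *)
pose KM : set (cone X) := [set q | (cone_rad q <= n%:R)%R /\ (cone_rad q = 0%R \/ K (cone_pt xbar q))].
have mKM : measurable (KM : set (borel (cone X))).
  rewrite (_ : KM = (@cone_rad R X) @^-1` `]-oo, n%:R] `&`
     ((@cone_rad R X) @^-1` [set 0%R] `|` cone_pt xbar @^-1` K)); last first.
    by apply/seteqP; split=> q /=; rewrite in_itv.
  apply: measurableI.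
    by rewrite -[X in measurable X]setTI; exact: measurable_cone_rad.
  apply: measurableU.
    by rewrite -[X in measurable X]setTI; exact: measurable_cone_rad.
  by rewrite -[X in measurable X]setTI; exact: measurable_cone_pt.
exists KM; split=> //.
  rewrite (_ : KM = conept @` (K `*` [set` `[0%R, n%:R]] `|` [set (xbar, 0%R)])).
    apply: continuous_compact.
      by apply: continuous_subspaceT => u; exact: continuous_conept.
    apply: compactU; last exact: compact_set1.
    by apply: compact_setX => //; exact: segment_compact.
  apply/seteqP; split=> [q [qn qK]|_ [[x r] [[Kx xr]|[-> ->]] <-]] /=.
  - case: qK => [q0|Kq].
      exists (xbar, 0%R); first by right.
      by rewrite -[RHS](coneptK xbar) q0; exact: conept0.
    exists (cone_pt xbar q, cone_rad q); last exact: coneptK.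
    by left; split=> //=; rewrite in_itv/= cone_rad_ge0.
  - move: Kx xr; rewrite /= in_itv/= => Kx /andP[r0 rn]; split; first by rewrite cone_rad_conept.
    rewrite cone_rad_conept//; have [->|rn0] := eqVneq r 0%R; [by left|right].
    by rewrite cone_pt_conept.
  - by split; [|left]; rewrite cone_rad_conept// ler0n.
rewrite [e]splitr EFinD; apply: le_trans (leeD Ke (ltW Mn)).
apply: measure_subU_le => //.
- by rewrite -[X in measurable X]setTI; apply: mp => //; exact: measurableC.
- by rewrite -[X in measurable X]setTI; apply: mxp => //; exact: measurableC.
- move=> w /= /not_andP[/negP h|/not_orP[_ nK]]; last by left.
  by right; rewrite ltNge.
Qed.

Lemma measurable_cone_fst : measurable_fun setT
  (fst : borel (cone X * cone X)%type -> borel (cone X)).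
Proof. apply: continuous_borel => p; exact: cvg_fst. Qed.

Lemma measurable_cone_snd : measurable_fun setT
  (snd : borel (cone X * cone X)%type -> borel (cone X)).
Proof. apply: continuous_borel => p; exact: cvg_snd. Qed.

Lemma measurable_cone_maps (xbar : X) :
  [/\ measurable_fun setT (cone_pt xbar \o fst : borel (cone X * cone X)%type -> borel X),
      measurable_fun setT (cone_pt xbar \o snd : borel (cone X * cone X)%type -> borel X),
      measurable_fun setT (@cone_rad R X \o fst : borel (cone X * cone X)%type -> R) &
      measurable_fun setT (@cone_rad R X \o snd : borel (cone X * cone X)%type -> R)].
Proof.
split.
- by apply: (measurableT_comp (measurable_cone_pt xbar)); exact: measurable_cone_fst.
- by apply: (measurableT_comp (measurable_cone_pt xbar)); exact: measurable_cone_snd.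
- by apply: (measurableT_comp measurable_cone_rad); exact: measurable_cone_fst.
- by apply: (measurableT_comp measurable_cone_rad); exact: measurable_cone_snd.
Qed.

Lemma cone_tight (xbar : X)
  (mu : {finite_measure set (borel (cone X * cone X)%type) -> \bar R}) : tight mu.
Proof.
move=> e e0; have e20 : (0 < e / 2)%R by rewrite divr_gt0.
have [K [cK mK Ke]] := cone_tight_preimage xbar mu measurable_cone_fst e20.
have [L [cL mL Le]] := cone_tight_preimage xbar mu measurable_cone_snd e20.
have mK1 : measurable (fst @^-1` K : set (borel (cone X * cone X)%type)).
  by rewrite -[X in measurable X]setTI; exact: measurable_cone_fst.
have mL1 : measurable (snd @^-1` L : set (borel (cone X * cone X)%type)).
  by rewrite -[X in measurable X]setTI; exact: measurable_cone_snd.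
exists (K `*` L); split; first exact: compact_setX.
  by rewrite (_ : _ `*` _ = fst @^-1` K `&` snd @^-1` L)//; exact: measurableI.
rewrite [e]splitr EFinD; apply: le_trans (leeD Ke Le).
apply: measure_subU_le.
- apply: measurableC.
  by rewrite (_ : _ `*` _ = fst @^-1` K `&` snd @^-1` L)//; exact: measurableI.
- by rewrite preimage_setC; exact: measurableC.
- by rewrite preimage_setC; exact: measurableC.
- by move=> [p q] /= /not_andP[]; [left|right].
Qed.

Lemma radon_of_tight {T : pseudoPMetricType R}
  (mu : {finite_measure set (borel T) -> \bar R}) : tight mu ->
  exists nu : radon_measure R T, radon_val nu = mu.
Proof. by move=> tmu; exists (RadonMeasure (tight_inner_regular tmu)). Qed.

Section realization.
Context {d : measure_display} {W : measurableType d}.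
Variable m : {finite_measure set W -> \bar R}.

(** [realizes x r mu]: the random point [[x, r]] of the cone, on the measure
    space [(W, m)], has homogeneous marginal [mu]. A plan between two measures
    is then just a pair of such random points on a common space. *)
Definition realizes (x : W -> X) (r : W -> R) (mu : set X -> \bar R) :=
  forall A : set X, measurable (A : set (borel X)) ->
    \int[m]_(w in x @^-1` A) (r w ^+ 2)%:E = mu A.

Lemma realizes_setT x r (mu : {finite_measure set (borel X) -> \bar R}) :
  realizes x r mu -> \int[m]_w (r w ^+ 2)%:E < +oo.
Proof.
move=> /(_ setT measurableT); rewrite preimage_setT => ->.
by rewrite ltey_eq fin_num_measure.
Qed.

Lemma measurable_real_strongly (r : W -> R) : measurable_fun setT r ->
  strongly_measurable r.
Proof.
move=> mr; apply: borel_strongly_measurable.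
  exists (range (@ratr R)); first exact: card_le_trans (card_image_le _ _) (countableP _).
  exact: dense_rat.
apply: borel_measurable_fun => U oU; rewrite -[X in measurable X]setTI.
by apply: mr => //; exact: open_measurable.
Qed.

(** Two random points of the cone on one space push [m] forward to a plan. Its
    Radon property is automatic by [cone_tight], and the values of the base
    points where the radius vanishes do not count in the marginals. *)
Lemma HK_le_cost (xbar : X) (x1 x2 : W -> X) (r1 r2 : W -> R)
  (mu1 mu2 : radon_measure R X) :
  strongly_measurable x1 -> strongly_measurable x2 ->
  measurable_fun setT r1 -> measurable_fun setT r2 ->
  (forall w, 0 <= r1 w)%R -> (forall w, 0 <= r2 w)%R ->
  realizes x1 r1 mu1 -> realizes x2 r2 mu2 ->
  HK xbar mu1 mu2 <= sqrte (\int[m]_w (cone_cost (x1 w) (r1 w) (x2 w) (r2 w))%:E).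
Proof.
move=> sx1 sx2 mr1 mr2 r10 r20 re1 re2.
have sr1 := measurable_real_strongly mr1.
have sr2 := measurable_real_strongly mr2.
pose Phi w := (conept (x1 w, r1 w), conept (x2 w, r2 w)).
have sPhi : strongly_measurable Phi.
  apply: strongly_measurable_pair;
    apply: (strongly_measurable_comp continuous_conept);
    exact: strongly_measurable_pair.
have mPhi := strongly_measurable_borel sPhi.
have [mu muE muI] := finite_pushforward m mPhi.
have [alpha alphaE] := radon_of_tight (cone_tight xbar mu).
have mrad1 : measurable_fun setT (fun p : borel (cone X * cone X)%type => (cone_rad p.1 ^+ 2)%R).
  by apply: measurable_funX; exact: (measurableT_comp measurable_cone_rad measurable_cone_fst).
have mrad2 : measurable_fun setT (fun p : borel (cone X * cone X)%type => (cone_rad p.2 ^+ 2)%R).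
  by apply: measurable_funX; exact: (measurableT_comp measurable_cone_rad measurable_cone_snd).
have mdist : measurable_fun setT (fun p : borel (cone X * cone X)%type => (cone_dist p.1 p.2 ^+ 2)%R).
  apply: measurable_funX; apply: (measurability _ (RGenOpens.measurableE R)).
  move=> _ [_ [a [b ->]] <-]; rewrite setTI; apply: borel_open.
  have /continuousP := @continuous_cone_dist R X.
  by apply; exact: interval_open.
have marg (pr : cone X * cone X -> cone X) (x : W -> X) (r : W -> R) (nu : radon_measure R X) :
    measurable_fun setT (pr : borel (cone X * cone X)%type -> borel (cone X)) ->
    (forall w, pr (Phi w) = conept (x w, r w)) -> strongly_measurable x ->
    measurable_fun setT r -> (forall w, 0 <= r w)%R -> realizes x r nu ->
    forall A, measurable A -> hmarg xbar pr alpha A = nu A.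
  move=> mpr prE sx mr r0 rx A mA; rewrite -(rx A mA) /hmarg /pushforward alphaE muI//.
  - have mx := strongly_measurable_borel sx.
    under eq_integral do rewrite prE cone_rad_conept//.
    rewrite [LHS]integral_mkcond [RHS]integral_mkcond.
    apply: eq_integral => w _; rewrite !patchE.
    have [->|rn0] := eqVneq (r w) 0%R; first by rewrite expr0n; case: ifP; case: ifP.
    have -> : (w \in Phi @^-1` ((cone_pt xbar \o pr) @^-1` A)) = (w \in x @^-1` A).
      by apply/idP/idP; rewrite !inE/= prE cone_pt_conept.
    by [].
  - rewrite -[X in measurable X]setTI.
    by apply: (measurableT_comp (measurable_cone_pt xbar) mpr).
  - apply/measurable_EFinP; apply: measurable_funX.
    exact: (measurableT_comp measurable_cone_rad mpr).
  - by move=> p; rewrite lee_fin sqr_ge0.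
rewrite /HK lee_sqrt; last first.
  by apply: integral_ge0 => w _; rewrite lee_fin cone_cost_ge0.
apply: ereal_inf_lbound; exists alpha.
  split.
  - rewrite /coneM2/= alphaE muI//; last 2 first.
    + apply/measurable_EFinP; exact: (measurable_funD mrad1 mrad2).
    + by move=> p; rewrite lee_fin addr_ge0 ?sqr_ge0.
    under eq_integral do rewrite EFinD.
    rewrite preimage_setT.
    under eq_integral do rewrite /Phi/= !cone_rad_conept//.
    rewrite ge0_integralD//; last 4 first.
    + by move=> w _; rewrite lee_fin sqr_ge0.
    + by apply/measurable_EFinP; exact: measurable_funX.
    + by move=> w _; rewrite lee_fin sqr_ge0.
    + by apply/measurable_EFinP; exact: measurable_funX.
    by apply: lte_add_pinfty; [exact: realizes_setT re1|exact: realizes_setT re2].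
  - by apply: (marg fst x1 r1) => //; exact: measurable_cone_fst.
  - by apply: (marg snd x2 r2) => //; exact: measurable_cone_snd.
rewrite alphaE muI//; last 2 first.
- by apply/measurable_EFinP.
- by move=> p; rewrite lee_fin sqr_ge0.
apply: eq_integral => w _; rewrite /Phi/= cone_dist_conept// sqr_sqrtr//.
exact: cone_cost_ge0.
Qed.

End realization.

(** Conversely a plan is a pair of random points on the space [cone X * cone X]
    itself. *)
Lemma HK_lt_realize (xbar : X) (mu1 mu2 : radon_measure R X) (e : R) :
  (0 < e)%R -> HK xbar mu1 mu2 < e%:E ->
  exists alpha : {finite_measure set (borel (cone X * cone X)%type) -> \bar R},
    let x (p : cone X) := cone_pt xbar p in
    [/\ realizes alpha (x \o fst) (@cone_rad R X \o fst) mu1,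
        realizes alpha (x \o snd) (@cone_rad R X \o snd) mu2 &
        \int[alpha]_p (cone_cost (x p.1) (cone_rad p.1) (x p.2) (cone_rad p.2))%:E
          < (e ^+ 2)%:E].
Proof.
move=> e0; rewrite /HK => he.
have : ereal_inf [set \int[alpha]_p ((cone_dist p.1 p.2 ^+ 2)%R)%:E
                   | alpha in hk_plans xbar mu1 mu2] < (e ^+ 2)%:E.
  rewrite !ltNge in he *; apply: contra he => he.
  rewrite -(ger0_norm (ltW e0)) -sqrtr_sqr -[X in X <= _]/(sqrte (e ^+ 2)%:E).
  by rewrite lee_sqrt//; apply: le_trans he; rewrite lee_fin sqr_ge0.
case/ereal_inf_lt => _ [alpha [_ h1 h2] <-] he2.
exists alpha; split => [A mA|A mA|].
- by rewrite -h1.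
- by rewrite -h2.
by under eq_integral do rewrite -(cone_dist_sqr xbar).
Qed.
End cone_plans.

(** * Splitting atomless measures *)

Section splitting.
Context {R : realType}.
Local Open Scope ereal_scope.

Lemma measure_chain_le {d} {W : measurableType d}
  (rho : {measure set W -> \bar R}) (A : (set W)^nat) (c : \bar R) :
  0 <= c -> (forall n, measurable (A n)) ->
  (forall i j, A i `<=` A j \/ A j `<=` A i) -> (forall n, rho (A n) <= c) ->
  rho (\bigcup_n A n) <= c.
Proof.
move=> c0 mA chA Ac; rewrite -bigcup_bigsetU_bigcup.
have mB n : measurable (\big[setU/set0]_(i < n.+1) A i).
  by apply: bigsetU_measurable.
have Bc n : rho (\big[setU/set0]_(i < n.+1) A i) <= c.
  suff [k Bk] : exists k, \big[setU/set0]_(i < n.+1) A i `<=` A k.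
    by apply: le_trans (Ac k); apply: le_measure; rewrite ?inE.
  elim: n => [|n [k Bk]]; first by exists 0%N; rewrite big_ord1.
  rewrite big_ord_recr/=; have [kn|nk] := chA k n.+1.
    by exists n.+1 => x [/Bk/kn|].
  by exists k => x [/Bk|/nk].
have cv := @nondecreasing_cvg_mu _ _ _ rho _ mB (bigcup_measurable (fun n _ => mB n)).
have {}cv := cv _; have {}cv : rho \o (fun n => \big[setU/set0]_(i < n.+1) A i) @ \oo -->
    rho (\bigcup_n \big[setU/set0]_(i < n.+1) A i).
  by apply: cv => n k nk; apply/subsetPset; exact: (@subset_bigsetU _ A n.+1 k.+1).
rewrite -(cvg_lim _ cv)//; apply: lime_le; first by apply/cvg_ex; eexists; exact: cv.
by apply: nearW.
Qed.

(** The mass of a half-line [S] is at most the supremum of the masses of the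
    closed half-lines [G q], [q] in [S]: rational endpoints exhaust [S] up to
    one point, which has no mass. The hypotheses on [G] are symmetric in the
    order, so that the lemma serves for initial and for final segments. *)
Lemma atomless_interval_le (rho : {measure set R -> \bar R}) (S : set R)
  (G : R -> set R) (c : \bar R) :
  0 <= c -> (forall t, rho [set t] = 0) -> measurable S ->
  (forall q, measurable (G q)) ->
  (forall p q, G p `<=` G q \/ G q `<=` G p) ->
  (forall q, S q -> rho (G q) <= c) ->
  (forall x y, S x -> S y -> (x < y)%R -> 
     exists q : rat, S (ratr q) /\ (G (ratr q) x \/ G (ratr q) y)) ->
  rho S <= c.
Proof.
move=> c0 rho0 mS mG chG Gc dense.
pose A n := if unpickle n is Some q then
  if `[< S (ratr q) >] then G (ratr q) else set0 else set0.
have mA n : measurable (A n).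
  by rewrite /A; case: unpickle => // q; case: asboolP.
have Ac : rho (\bigcup_n A n) <= c.
  apply: measure_chain_le => //.
  - move=> i j; rewrite /A; case: unpickle => [p|]; last by left.
    case: asboolP => _; last by left.
    case: unpickle => [q|]; last by right.
    by case: asboolP => _; [exact: chG|right].
  - move=> n; rewrite /A; case: unpickle => [q|]; last by rewrite measure0.
    by case: asboolP => [/Gc//|_]; rewrite measure0.
have mUA : measurable (\bigcup_n A n) by exact: bigcup_measurable.
have N0 : rho (S `\` \bigcup_n A n) = 0.
  have [->|/set0P[x [Sx nx]]] := eqVneq (S `\` \bigcup_n A n) set0.
    exact: measure0.
  apply/eqP; rewrite eq_le measure_ge0 andbT -(rho0 x).
  apply: le_measure; rewrite ?inE//; first exact: measurableD.
  have AE (q : rat) : S (ratr q) -> A (pickle q) = G (ratr q).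
    by move=> Sq; rewrite /A pickleK asboolT.
  have Aq (q : rat) z : S (ratr q) -> G (ratr q) z -> (\bigcup_n A n) z.
    by move=> Sq Gq; exists (pickle q); [exact: I|rewrite AE].
  move=> y [Sy ny] /=; apply/eqP; rewrite eq_le !leNgt; apply/andP; split; apply/negP => xy.
    have [q [Sq []/(Aq _ _ Sq)]] := dense _ _ Sx Sy xy; [exact: nx|exact: ny].
  have [q [Sq []/(Aq _ _ Sq)]] := dense _ _ Sy Sx xy; [exact: ny|exact: nx].
apply: le_trans Ac; rewrite -[leRHS]add0e -N0.
apply: measure_subU_le => //; first exact: measurableD.
by move=> x Sx; have [?|?] := pselect ((\bigcup_n A n) x); [right|left].
Qed.

Lemma rational_between (x y : R) : (x < y)%R ->
  exists q : rat, (x < ratr q < y)%R.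
Proof.
by move=> xy; have [q] := rat_in_itvoo xy; rewrite in_itv/= => h; exists q.
Qed.

(** The distribution function takes every value: without atoms the initial
    segment where it is below [c] has mass exactly [c]. It has at most mass [c]
    as a union of half-lines of mass below [c], and its complement has at most
    the remaining mass for the same reason. *)
Lemma atomless_sublevel (rho : {finite_measure set R -> \bar R}) (c : R) :
  (forall t, rho [set t] = 0) -> (0 <= c)%R -> c%:E <= rho setT ->
  let S := [set t : R | rho `]-oo, t]%classic < c%:E] in
  measurable S /\ rho S = c%:E.
Proof.
move=> rho0 c0 cT S.
have mono s t : (s <= t)%R -> rho `]-oo, s]%classic <= rho `]-oo, t]%classic.
  move=> st; apply: le_measure; rewrite ?inE//.
  by apply: subset_itvl; rewrite bnd_simp.
have mS : measurable S.
  apply: is_interval_measurable => s t _ St u /andP[_ ut].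
  by rewrite /S/=; apply: le_lt_trans St; exact: mono.
split=> //.
have fin A : measurable A -> rho A \is a fin_num by move=> mA; rewrite fin_num_measure.
have tot A : measurable A -> (fine (rho A) + fine (rho (~` A)) = fine (rho setT))%R.
  move=> mA; apply: EFin_inj; rewrite EFinD !fineK ?fin//; last exact: measurableC.
  by rewrite -measureU ?setUv ?setICr//; exact: measurableC.
have h1 : rho S <= c%:E.
  apply: (@atomless_interval_le _ _ (fun t => `]-oo, t]%classic)) => //.
  - move=> p q; have [pq|/ltW pq] := leP p q; [left|right];
      by apply: subset_itvl; rewrite bnd_simp.
  - by move=> q /ltW.
  - move=> x y Sx Sy /rational_between[q /andP[xq qy]]; exists q; split.
      by rewrite /S/=; apply: le_lt_trans Sy; apply: mono; exact: ltW.
    by left; rewrite /= in_itv/= ltW.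
have h2 : rho (~` S) <= (fine (rho setT) - c)%:E.
  apply: (@atomless_interval_le _ _ (fun t => `[t, +oo[%classic)) => //.
  - by rewrite lee_fin subr_ge0 -lee_fin fineK// fin.
  - exact: measurableC.
  - move=> p q; have [pq|/ltW pq] := leP p q; [right|left];
      by apply: subset_itvr; rewrite bnd_simp.
  - move=> q /negP; rewrite -leNgt => cq.
    rewrite -(@setU1itv _ _ _ _ false)//; apply: le_trans (measureU2 _ _ _) _ => //.
    rewrite [X in X + _](rho0 q) add0e.
    have mq : measurable `]-oo, q]%classic by [].
    have mq' : measurable `]q, +oo[%classic by [].
    have := tot _ mq; rewrite setCitvl => <-.
    move: cq; rewrite -{1}(fineK (fin _ mq)) lee_fin => cq; rewrite -[leLHS](fineK (fin _ mq')) lee_fin.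
    by clear h1 cT; lra.
  - move=> x y /negP Sx /negP Sy /rational_between[q /andP[xq qy]]; exists q; split.
      rewrite -leNgt in Sx; apply/negP; rewrite -leNgt.
      by apply: le_trans Sx _; apply: mono; exact: ltW.
    by right; rewrite /= in_itv/= andbT ltW.
have := tot S mS; move: h1 h2.
rewrite -(fineK (fin _ mS)) -(fineK (fin _ (measurableC mS))) !lee_fin => h1 h2 h3.
by congr EFin; apply/eqP; rewrite eq_le h1/=; clear mono tot cT; lra.
Qed.

(** The pieces are the level sets of the distribution function between
    consecutive partial sums of the prescribed masses. *)
Lemma atomless_split (rho : {finite_measure set R -> \bar R}) (a : nat -> R) :
  (forall t, rho [set t] = 0) -> (forall j, 0 <= a j)%R ->
  \sum_(j <oo) (a j)%:E = rho setT ->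
  exists2 K : R -> nat, measurable_fun setT K &
    forall j, rho (K @^-1` [set j]) = (a j)%:E.
Proof.
move=> rho0 a0 aT.
pose A j : R := (\sum_(0 <= i < j) a i)%R.
pose S j := [set t : R | rho `]-oo, t]%classic < (A j)%:E].
have A0 j : (0 <= A j)%R by apply: sumr_ge0.
have AT j : (A j)%:E <= rho setT.
  rewrite -aT -sumEFin; apply: nneseries_lim_ge => i _ _; by rewrite lee_fin.
have SA j : measurable (S j) /\ rho (S j) = (A j)%:E by exact: atomless_sublevel.
have mS j := (SA j).1; have rS j := (SA j).2.
have AS j : A j.+1 = (A j + a j)%R by rewrite /A big_nat_recr.
have SS j : S j `<=` S j.+1.
  by move=> t /lt_le_trans; apply; rewrite lee_fin AS lerDl.
have Smono i j : (i <= j)%N -> S i `<=` S j.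
  by move=> /subnKC <-; elim: (j - i)%N => [|n IH]; rewrite ?addn0// addnS;
    exact: subset_trans (SS _).
(* the part beyond all partial sums, which is negligible *)
pose L := ~` \bigcup_j S j.+1.
have mL : measurable L by apply: measurableC; exact: bigcup_measurable.
have fin B : measurable B -> rho B \is a fin_num by move=> mB; rewrite fin_num_measure.
have L0 : rho L = 0.
  have LA n : (A n)%:E + rho L <= rho setT.
    rewrite -rS -measureU//.
      by apply: le_measure; rewrite ?inE//; exact: measurableU.
    rewrite -subset0 => t [St]; apply; exists n => //; exact: SS.
  have : rho setT + rho L <= rho setT.
    rewrite -{1}aT.
    have cv : (fun n => \sum_(0 <= i < n) (a i)%:E + rho L) @ \oo -->
        \sum_(j <oo) (a j)%:E + rho L.
      apply: cvgeD; last exact: cvg_cst.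
        by rewrite fin_num_adde_defl// fin.
      by apply: is_cvg_nneseries => n _ _; rewrite lee_fin.
    rewrite -(cvg_lim _ cv)//; apply: lime_le; first by apply/cvg_ex; eexists; exact: cv.
    by apply: nearW => n; rewrite sumEFin; exact: LA.
  rewrite -[leRHS]adde0 leeD2lE ?fin// => L0.
  by apply/eqP; rewrite eq_le L0 measure_ge0.
have [||K mK KP] := @first_index _ R (fun n => S n.+1 `|` L).
- by move=> n; exact: measurableU.
- move=> t; have [[n _ Sn]|nS] := pselect ((\bigcup_j S j.+1) t).
    by exists n; left.
  by exists 0%N; right.
exists K => // j.
have S0 : S 0%N = set0.
  by rewrite -subset0 => t; rewrite /S/= /A big_nil ltNge measure_ge0.
have KE : K @^-1` [set j] = (S j.+1 `\` S j) `|` (if j == 0%N then L else set0).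
  apply/seteqP; split=> [t /= Kt|t /=].
    have [] := KP t; rewrite Kt => -[Sj|Lt] Kmin.
      left; split=> //; case: j {Kt} Kmin Sj => [|j] Kmin Sj; first by rewrite S0.
      by move=> Sj'; apply: (Kmin j) => //; left.
    right; case: j {Kt} Kmin => [//|j] /(_ 0%N isT) []; by right.
  have [] := KP t => KSL Kmin [[Sj nSj]|].
    apply/eqP; rewrite eqn_leq; apply/andP; split.
      by rewrite leqNgt; apply/negP => /Kmin; apply; left.
    rewrite leqNgt; apply/negP => Kj; case: KSL => [SK|Lt].
      by apply: nSj; exact: Smono SK.
    by apply: Lt; exists j.
  case: eqP => [-> Lt|//]; apply/eqP; rewrite -leqn0 leqNgt.
  by apply/negP => /Kmin; apply; right.
rewrite KE measureU; last 3 first.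
- exact: measurableD.
- by case: ifP.
- case: ifP => _; last by rewrite setI0.
  by rewrite -subset0 => t [[Sj _]]; apply; exists j.
rewrite [X in _ + X](_ : _ = 0); last by case: ifP => // _; rewrite measure0.
rewrite adde0 measureD//; last by rewrite ltey_eq fin.
rewrite setIidr; last exact: SS.
transitivity (rho (S j.+1) - rho (S j)) => //.
by rewrite !rS -EFinB AS addrAC subrr add0r.
Qed.

End splitting.

(** * Integrals over the cells of a countable partition *)

Section cells.
Context {R : realType} {d : measure_display} {W : measurableType d}.
Variable m : {measure set W -> \bar R}.
Local Open Scope ereal_scope.

Lemma measurable_preimage {d'} {T : measurableType d'} (f : W -> T) (A : set T) :
  measurable_fun setT f -> measurable A -> measurable (f @^-1` A).
Proof. by move=> mf mA; rewrite -[X in measurable X]setTI; exact: mf. Qed.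

Lemma measurable_cell (c : W -> nat) (A : set nat) :
  measurable_fun setT c -> measurable (c @^-1` A).
Proof. by move=> mc; exact: measurable_preimage. Qed.

Lemma integral_cells (c : W -> nat) (D : set W) (f : W -> \bar R) :
  measurable_fun setT c -> measurable D -> measurable_fun setT f ->
  (forall w, 0 <= f w) ->
  \int[m]_(w in D) f w = \sum_(n <oo) \int[m]_(w in D `&` c @^-1` [set n]) f w.
Proof.
move=> mc mD mf f0.
have mDc n : measurable (D `&` c @^-1` [set n]).
  by apply: measurableI => //; exact: measurable_cell.
rewrite -ge0_integral_bigcup//.
- congr integral; apply/seteqP; split=> [w Dw|w [n _ []]//].
  by exists (c w).
- exact: measurable_funTS.
- apply/trivIsetP => i j _ _ ij; rewrite -subset0 => w [[_ /= wi] [_ /= wj]].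
  by move: ij; rewrite -wi -wj eqxx.
Qed.

End cells.

Section compare_cells.
Context {R : realType} {d : measure_display} {W : measurableType d}
  {d' : measure_display} {V : measurableType d'}.
Variables (m : {measure set W -> \bar R}) (a : {measure set V -> \bar R}).
Local Open Scope ereal_scope.

Lemma eq_integral_cells (c : W -> nat) (D : set W) (f : W -> \bar R)
    (c' : V -> nat) (D' : set V) (f' : V -> \bar R) :
  measurable_fun setT c -> measurable D -> measurable_fun setT f ->
  measurable_fun setT c' -> measurable D' -> measurable_fun setT f' ->
  (forall w, 0 <= f w) -> (forall v, 0 <= f' v) ->
  (forall n, \int[m]_(w in D `&` c @^-1` [set n]) f w =
             \int[a]_(v in D' `&` c' @^-1` [set n]) f' v) ->
  \int[m]_(w in D) f w = \int[a]_(v in D') f' v.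
Proof.
move=> mc mD mf mc' mD' mf' f0 f'0 ff'.
by rewrite (integral_cells _ mc)// (integral_cells _ mc')//; exact: eq_eseriesr.
Qed.

Lemma le_integral_cells (c : W -> nat) (D : set W) (f : W -> \bar R)
    (c' : V -> nat) (D' : set V) (f' : V -> \bar R) :
  measurable_fun setT c -> measurable D -> measurable_fun setT f ->
  measurable_fun setT c' -> measurable D' -> measurable_fun setT f' ->
  (forall w, 0 <= f w) -> (forall v, 0 <= f' v) ->
  (forall n, \int[m]_(w in D `&` c @^-1` [set n]) f w <=
             \int[a]_(v in D' `&` c' @^-1` [set n]) f' v) ->
  \int[m]_(w in D) f w <= \int[a]_(v in D') f' v.
Proof.
move=> mc mD mf mc' mD' mf' f0 f'0 ff'.
rewrite (integral_cells _ mc)// (integral_cells _ mc')//.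
by apply: lee_nneseries => // n _ _; exact: integral_ge0.
Qed.

End compare_cells.

(** * The reference probability space *)

Section reference_space.
Context {R : realType}.
Local Open Scope ereal_scope.

Lemma atomless_density_split (m : {finite_measure set R -> \bar R})
    (h : R -> \bar R) (D : set R) (a : nat -> R) :
  (forall t, m [set t] = 0) -> measurable D ->
  measurable_fun setT h -> (forall w, 0 <= h w) ->
  (forall j, 0 <= a j)%R ->
  \sum_(j <oo) (a j)%:E = \int[m]_(w in D) h w -> \int[m]_(w in D) h w < +oo ->
  exists2 K : R -> nat, measurable_fun setT K &
    forall j, \int[m]_(w in D `&` K @^-1` [set j]) h w = (a j)%:E.
Proof.
move=> m0 mD mh h0 a0 aD Doo.
have mhD : measurable_fun setT (h \_ D) by apply/(measurable_restrictT _ mD); exact: measurable_funTS.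
have hD0 w : 0 <= (h \_ D) w by rewrite patchE; case: ifP.
have [|rho rhoE] := @finite_density R _ _ m _ mhD hD0.
  by rewrite -integral_mkcond.
have rhoE' A : rho A = \int[m]_(w in D `&` A) h w by rewrite rhoE -integral_mkcondl.
have rho0 t : rho [set t] = 0.
  rewrite rhoE null_set_integral//; first exact: measurable_funTS.
  exact: m0.
have [|K mK KP] := atomless_split rho0 a0; first by rewrite rhoE' setIT.
by exists K => // j; rewrite -KP rhoE'.
Qed.

(** Infinitely many disjoint regions [N = k] of positive mass are provided: each
    will be used once, as the place where new mass is created. *)
Lemma reference_measure : exists (m : {finite_measure set R -> \bar R})
    (N : R -> nat),
  [/\ forall t, m [set t] = 0, measurable_fun setT N &
      forall k, 0 < m (N @^-1` [set k])].
Proof.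
have l1 : (@lebesgue_measure R) `[0%R, 1%R]%classic < +oo.
  by rewrite lebesgue_measure_itv/= lte_fin ltr01 EFinN sube0 ltry.
have mI : measurable (`[0%R, 1%R]%classic : set R) by [].
have [m mE] : exists m : {finite_measure set R -> \bar R},
    forall A, m A = lebesgue_measure (A `&` `[0%R, 1%R]%classic).
  have [|m mE] := @finite_measure_of R _ _ (mrestr (@lebesgue_measure R) mI).
    by rewrite /= /mrestr setTI.
  have mid : measurable_fun setT (id : measurableTypeR R -> R).
    by move=> _ A mA; rewrite setTI.
  have [mu muE _] := finite_pushforward m mid.
  by exists mu => A; rewrite muE mE.
have m0 t : m [set t] = 0.
  apply/eqP; rewrite eq_le measure_ge0 andbT mE -(lebesgue_measure_set1 t).
  by apply: le_measure; rewrite ?inE//; exact: measurableI.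
have a0 k : (0 <= 1 / (2 ^ (k + 1))%:R :> R)%R by rewrite divr_ge0.
have [|N mN NP] := atomless_split m0 a0.
  rewrite mE setTI lebesgue_measure_itv/= lte_fin ltr01 sube0.
  apply/cvg_lim => //; rewrite -[X in _ --> X%:E]divr1 -(expr0 2%R).
  exact: (@cvg_geometric_eseries_half R 1 0).
by exists m, N; split=> // k; rewrite NP lte_fin divr_gt0// ltr0n expn_gt0.
Qed.

End reference_space.

(** * Lumping the radii on a cell *)

Section weighted_cost.
Context {R : realType}.
Implicit Types r s k t a b c : R.

(** The cone cost of radii [r], [s] at base points whose distance has cosine
    [k]; on a cell of a discretized plan only the radii vary. *)
Definition wcost r s k := r ^+ 2 + s ^+ 2 - 2 * r * s * k.

Lemma wcost_ge0 r s k : 0 <= r -> 0 <= s -> -1 <= k <= 1 -> 0 <= wcost r s k.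
Proof.
move=> r0 s0 /andP[_ k1]; have := sqr_ge0 (r - s).
have : r * s * k <= r * s by rewrite ler_piMr// mulr_ge0.
rewrite /wcost sqrrB; lra.
Qed.

Lemma wcost_le r s k : 0 <= r -> 0 <= s -> -1 <= k <= 1 ->
  wcost r s k <= 2 * r ^+ 2 + 2 * s ^+ 2.
Proof.
move=> r0 s0 /andP[k1 _]; have := sqr_ge0 (r - s).
have : r * s * (- k) <= r * s by rewrite ler_piMr ?mulr_ge0// lerNl.
rewrite /wcost sqrrB; lra.
Qed.

(** The linearized Cauchy-Schwarz inequality [2 r s <= t r^2 + s^2 / t]
    integrates at once, and the best [t] is chosen after integration. *)
Lemma wcost_lower r s k t : 0 <= r -> 0 <= s -> 0 < t ->
  r ^+ 2 + s ^+ 2 <= wcost r s k + Num.max k 0 * (t * r ^+ 2 + s ^+ 2 / t).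
Proof.
move=> r0 s0 t0; have h : 2 * r * s <= t * r ^+ 2 + s ^+ 2 / t.
  have : 0 <= (t * r - s) ^+ 2 / t by rewrite divr_ge0 ?sqr_ge0// ltW.
  have -> : (t * r - s) ^+ 2 / t = t * r ^+ 2 - 2 * r * s + s ^+ 2 / t.
    by field; rewrite gt_eqF.
  lra.
have rs0 : 0 <= 2 * r * s by rewrite !mulr_ge0.
rewrite /wcost; have [k0|k0] := leP k 0.
  by rewrite mul0r; nra.
by have : k * (2 * r * s) <= k * (t * r ^+ 2 + s ^+ 2 / t);
  [rewrite ler_wpM2l// ltW|lra].
Qed.

(** Let [a], [b] be the integrals of the squared radii on a cell and [c] the cost
    of the plan there. Replacing the plan by the single ratio [sqrt (b / a)] of
    radii costs at most [4 c]: with [t = sqrt (b / a)] the hypothesis is the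
    comparison with the lumped cost when [k >= 0]; for [k < 0], or when one of
    the masses vanishes, a constant factor is lost. *)
Lemma lumped_cost_le a b c k : 0 <= a -> 0 <= b -> 0 <= c -> -1 <= k <= 1 ->
  (forall t, 0 < t -> a + b <= c + Num.max k 0 * (t * a + b / t)) ->
  (if 0 < a then a * wcost 1 (Num.sqrt (b / a)) k else 2 * b) <= 4 * c.
Proof.
move=> a0 b0 c0 /andP[k1 k2] abc.
have /andP[km0 km1] : 0 <= Num.max k 0 <= 1 by rewrite le_max lexx orbT ge_max k2/=.
have [ap|ha] := ltP 0 a; last first.
  have {}ha : a = 0 by apply/eqP; rewrite eq_le ha a0.
  (* [t = 2] leaves half of [b] on the left; below, [t = 1/2] leaves half of [a] *)
  by have := abc 2 ltac:(lra); rewrite ha; nra.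
have [hb|bp] := leP b 0.
  have {}hb : b = 0 by apply/eqP; rewrite eq_le hb b0.
  have := abc 2^-1 ltac:(lra); rewrite hb !mul0r sqrtr0 /wcost; nra.
have s0 : 0 < Num.sqrt (b / a) by rewrite sqrtr_gt0 divr_gt0.
have s2 : Num.sqrt (b / a) ^+ 2 * a = b.
  by rewrite sqr_sqrtr ?divr_ge0// divfK// gt_eqF.
have := abc _ s0; move: s0 s2; set s := Num.sqrt _ => s0 s2.
have -> : b / s = s * a by rewrite -s2; field; rewrite gt_eqF.
have -> : a * wcost 1 s k = a + b - 2 * (s * a) * k.
  by rewrite /wcost -s2; ring.
have sa : 0 <= s * a by rewrite mulr_ge0// ltW.
have [k0|k0] := leP k 0; last by nra.
have h : (s - 1) ^+ 2 * a >= 0 by rewrite mulr_ge0// sqr_ge0.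
have h' : (s - 1) ^+ 2 * a = b - 2 * (s * a) + a by rewrite -s2; ring.
have : - (s * a * k) <= s * a by rewrite -mulrN ler_piMr// lerNl.
lra.
Qed.

End weighted_cost.

(** * Following a plan on the reference space *)

Section step.
Context {R : realType}.
Local Open Scope ereal_scope.

Lemma measurable_countably_valued {d} {W : measurableType d} {d'}
  {T : measurableType d'} (f : W -> T) :
  countably_valued f -> measurable_fun setT f.
Proof. by move=> cf _ A _; rewrite setTI; exact: countably_valued_preimage. Qed.

Lemma countably_valued_nat {d} {W : measurableType d} (n : W -> nat) :
  measurable_fun setT n -> countably_valued n.
Proof. by move=> mn; exists n, id. Qed.

Lemma measurable_nat2 {d} {W : measurableType d} {d'} {T : measurableType d'}
  (F : nat -> nat -> T) (i j : W -> nat) :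
  measurable_fun setT i -> measurable_fun setT j ->
  measurable_fun setT (fun w => F (i w) (j w)).
Proof.
move=> mi mj; apply: measurable_countably_valued.
exact: (@countably_valued_comp _ _ _ _ (fun w => (i w, j w)) (fun p => F p.1 p.2)
  (countably_valued_pair (countably_valued_nat mi) (countably_valued_nat mj))).
Qed.

Lemma measurable_wcost {d} {W : measurableType d} (r s k : W -> R) :
  measurable_fun setT r -> measurable_fun setT s -> measurable_fun setT k ->
  measurable_fun setT (fun w => wcost (r w) (s w) (k w)).
Proof.
move=> mr ms mk; apply: measurable_funB.
  by apply: measurable_funD; exact: measurable_funX.
by apply: measurable_funM => //; apply: measurable_funM => //; exact: measurable_funM.
Qed.

Context {dv : measure_display} {V : measurableType dv}.
Variables (alpha : {measure set V -> \bar R}) (I I' : V -> nat) (r r' : V -> R).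
Hypotheses (mI : measurable_fun setT I) (mI' : measurable_fun setT I')
  (mr : measurable_fun setT r) (mr' : measurable_fun setT r')
  (r0 : forall v, (0 <= r v)%R) (r'0 : forall v, (0 <= r' v)%R)
  (roo : \int[alpha]_v (r v ^+ 2)%:E < +oo)
  (r'oo : \int[alpha]_v (r' v ^+ 2)%:E < +oo).
Variables (m : {finite_measure set R -> \bar R}) (D1 D2 D3 : R -> nat).
Hypotheses (m0 : forall t, m [set t] = 0) (mD1 : measurable_fun setT D1)
  (mD2 : measurable_fun setT D2) (mD3 : measurable_fun setT D3)
  (D0 : forall n i j,
    0 < m (D1 @^-1` [set n] `&` (D2 @^-1` [set i] `&` D3 @^-1` [set j]))).

(** [D1] is the time at which a region of the reference space may receive its
    first mass, and [D2], [D3] name the cell of the plan that it then serves. *)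
Definition unborn n (rho : R -> R) := forall w, (n <= D1 w)%N -> rho w = 0%R.

Let cellV i j := I @^-1` [set i] `&` I' @^-1` [set j].
Let a i j := fine (\int[alpha]_(v in cellV i j) (r v ^+ 2)%:E).
Let b i j := fine (\int[alpha]_(v in cellV i j) (r' v ^+ 2)%:E).

Let mcellV i j : measurable (cellV i j).
Proof. by apply: measurableI; exact: measurable_cell. Qed.

Let msqr {d} {W : measurableType d} (f : W -> R) : measurable_fun setT f ->
  measurable_fun setT (fun w => (f w ^+ 2)%:E).
Proof. by move=> mf; apply/measurable_EFinP; exact: measurable_funX. Qed.

Let cell_fin (f : V -> R) i j : measurable_fun setT f ->
  \int[alpha]_v (f v ^+ 2)%:E < +oo ->
  \int[alpha]_(v in cellV i j) (f v ^+ 2)%:E \is a fin_num.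
Proof.
move=> mf foo; rewrite ge0_fin_numE; last first.
  by apply: integral_ge0 => v _; rewrite lee_fin sqr_ge0.
apply: le_lt_trans foo; apply: ge0_subset_integral => //.
- exact: msqr.
- by move=> v _; rewrite lee_fin sqr_ge0.
Qed.

Let aE i j : (a i j)%:E = \int[alpha]_(v in cellV i j) (r v ^+ 2)%:E.
Proof. by rewrite fineK// cell_fin. Qed.

Let bE i j : (b i j)%:E = \int[alpha]_(v in cellV i j) (r' v ^+ 2)%:E.
Proof. by rewrite fineK// cell_fin. Qed.

Let a0 i j : (0 <= a i j)%R.
Proof. by rewrite -lee_fin aE; apply: integral_ge0 => v _; rewrite lee_fin sqr_ge0. Qed.

Let b0 i j : (0 <= b i j)%R.
Proof. by rewrite -lee_fin bE; apply: integral_ge0 => v _; rewrite lee_fin sqr_ge0. Qed.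

Let cost_lower (kappa : R) i j t : (-1 <= kappa <= 1)%R -> (0 < t)%R ->
  (a i j + b i j)%:E <= \int[alpha]_(v in cellV i j) (wcost (r v) (r' v) kappa)%:E
     + (Num.max kappa 0 * (t * a i j + b i j / t))%:E.
Proof.
move=> k1 t0.
have k0 : (0 <= Num.max kappa 0)%R by rewrite le_max lexx orbT.
have -> : (Num.max kappa 0 * (t * a i j + b i j / t))%:E =
   \int[alpha]_(v in cellV i j)
     ((Num.max kappa 0 * t * r v ^+ 2)%:E + (Num.max kappa 0 / t * r' v ^+ 2)%:E).
  rewrite ge0_integralD//; last 4 first.
  - by move=> v _; rewrite lee_fin !mulr_ge0// ?sqr_ge0// ltW.
  - by apply: measurable_funTS; apply/measurable_EFinP; apply: measurable_funM => //; exact: measurable_funX.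
  - by move=> v _; rewrite lee_fin !mulr_ge0// ?sqr_ge0// invr_ge0 ltW.
  - by apply: measurable_funTS; apply/measurable_EFinP; apply: measurable_funM => //; exact: measurable_funX.
  under eq_integral do rewrite EFinM.
  rewrite ge0_integralZl_EFin//; last 3 first.
  - by move=> v _; rewrite lee_fin sqr_ge0.
  - by apply: measurable_funTS; exact: msqr.
  - by rewrite mulr_ge0// ltW.
  under [X in _ + X]eq_integral do rewrite EFinM.
  rewrite ge0_integralZl_EFin//; last 3 first.
  - by move=> v _; rewrite lee_fin sqr_ge0.
  - by apply: measurable_funTS; exact: msqr.
  - by rewrite mulr_ge0// invr_ge0 ltW.
  rewrite -aE -bE -!EFinM -EFinD; congr EFin; ring.
rewrite EFinD aE bE -ge0_integralD//; last 4 first.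
- by move=> v _; rewrite lee_fin sqr_ge0.
- by apply: measurable_funTS; exact: msqr.
- by move=> v _; rewrite lee_fin sqr_ge0.
- by apply: measurable_funTS; exact: msqr.
have mw : measurable_fun setT (fun v => (wcost (r v) (r' v) kappa)%:E).
  by apply/measurable_EFinP; exact: measurable_wcost.
rewrite -ge0_integralD//; last 4 first.
- by move=> v _; rewrite lee_fin wcost_ge0.
- exact: measurable_funTS.
- move=> v _; rewrite -EFinD lee_fin addr_ge0// !mulr_ge0// ?sqr_ge0// ?ltW//.
  by rewrite invr_gt0.
- apply: measurable_funTS; apply: emeasurable_funD; apply/measurable_EFinP;
    by apply: measurable_funM => //; exact: measurable_funX.
apply: ge0_le_integral => //.
- by move=> v _; rewrite -EFinD lee_fin addr_ge0// sqr_ge0.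
- apply: measurable_funTS; apply: emeasurable_funD; exact: msqr.
- apply: measurable_funTS; apply: emeasurable_funD => //.
  apply: emeasurable_funD; apply/measurable_EFinP;
    by apply: measurable_funM => //; exact: measurable_funX.
- move=> v _; rewrite -!EFinD lee_fin.
  apply: le_trans (wcost_lower kappa (r0 v) (r'0 v) t0) _.
  by rewrite lerD2l le_eqVlt; apply/orP; left; apply/eqP; ring.
Qed.

(** Suppose that [(J, rho)] carries on the reference space the discretized first
    marginal of a plan: [J] is the index of the base point and [rho] the radius.
    Split the region [J = i], measured by [rho^2 m], into pieces with the masses
    [a i j] that the plan moves from cell [i] to cell [j], let [J'] be [j] on the
    piece and multiply the radius by [sqrt (b i j / a i j)], which turns the mass
    [a i j] into [b i j]. When [a i j = 0] there is nothing to split, and the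
    mass [b i j] is created on a fresh region. By [lumped_cost_le] this does not
    cost more than four times the plan, cell by cell. *)
Lemma follow_plan n (J : R -> nat) (rho : R -> R) :
  measurable_fun setT J -> measurable_fun setT rho ->
  (forall w, (0 <= rho w)%R) -> unborn n rho ->
  (forall i, \int[m]_(w in J @^-1` [set i]) (rho w ^+ 2)%:E =
             \int[alpha]_(v in I @^-1` [set i]) (r v ^+ 2)%:E) ->
  exists (J' : R -> nat) (rho' : R -> R),
    [/\ measurable_fun setT J', measurable_fun setT rho',
        (forall w, (0 <= rho' w)%R), unborn n.+1 rho' &
        (forall j, \int[m]_(w in J' @^-1` [set j]) (rho' w ^+ 2)%:E =
             \int[alpha]_(v in I' @^-1` [set j]) (r' v ^+ 2)%:E) /\
        forall kappa : nat -> nat -> R, (forall i j, -1 <= kappa i j <= 1)%R ->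
          \int[m]_w (wcost (rho w) (rho' w) (kappa (J w) (J' w)))%:E <=
          4%:E * \int[alpha]_v (wcost (r v) (r' v) (kappa (I v) (I' v)))%:E].
Proof.
move=> mJ mrho rho0 ub Jrho.
have mJi i : measurable (J @^-1` [set i]) by exact: measurable_cell.
have sumA i : \sum_(j <oo) (a i j)%:E = \int[m]_(w in J @^-1` [set i]) (rho w ^+ 2)%:E.
  rewrite Jrho (integral_cells _ mI')//; last 3 first.
  - exact: measurable_cell.
  - exact: msqr.
  - by move=> v; rewrite lee_fin sqr_ge0.
  by apply: eq_eseriesr => j _; rewrite aE.
have /choice[K KP] i : exists K : R -> nat, measurable_fun setT K /\
    forall j, \int[m]_(w in J @^-1` [set i] `&` K @^-1` [set j]) (rho w ^+ 2)%:E = (a i j)%:E.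
  have [|||||||K mK KP] := @atomless_density_split R m (fun w => (rho w ^+ 2)%:E) (J @^-1` [set i]) (a i) => //.
  - exact: msqr.
  - by move=> w; rewrite lee_fin sqr_ge0.
  - rewrite Jrho; apply: le_lt_trans roo; apply: ge0_subset_integral => //.
    + exact: measurable_cell.
    + exact: msqr.
    + by move=> v _; rewrite lee_fin sqr_ge0.
  - by exists K.
(* the cell of the plan that [w] serves: on a fresh region the radius [rho]
   vanishes, so the base point may be renamed there *)
pose H w := if D1 w == n then D2 w else J w.
pose J' w := if D1 w == n then D3 w else K (J w) w.
have mD1n : measurable_fun setT (fun w => D1 w == n).
  exact: (@measurable_nat2 _ _ _ _ (fun i _ => i == n) D1 D1).
have mH : measurable_fun setT H by exact: measurable_fun_ifT.
have mK : measurable_fun setT (fun w => K (J w) w).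
  apply: measurable_fun_nat => k.
  rewrite [X in measurable X](_ : _ = \bigcup_i (J @^-1` [set i] `&` K i @^-1` [set k])).
    apply: bigcup_measurable => i _; apply: measurableI => //.
    by apply: measurable_cell; have [] := KP i.
  by apply/seteqP; split=> [w /= Kw|w [i _ [/= -> ->]]//]; exists (J w).
have mJ' : measurable_fun setT J' by exact: measurable_fun_ifT.
pose fr i j := fine (m (D1 @^-1` [set n] `&` (D2 @^-1` [set i] `&` D3 @^-1` [set j]))).
have mfr i j : measurable (D1 @^-1` [set n] `&` (D2 @^-1` [set i] `&` D3 @^-1` [set j])).
  by apply: measurableI; [|apply: measurableI]; exact: measurable_cell.
have frE i j : (fr i j)%:E = m (D1 @^-1` [set n] `&` (D2 @^-1` [set i] `&` D3 @^-1` [set j])).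
  by rewrite fineK// fin_num_measure.
have fr0 i j : (0 < fr i j)%R by rewrite -lte_fin frE.
pose s i j := (if 0 < a i j then Num.sqrt (b i j / a i j) else 0)%R.
pose t i j := (if 0 < a i j then 0 else Num.sqrt (b i j / fr i j))%R.
have s0 i j : (0 <= s i j)%R by rewrite /s; case: ifP => // _; exact: sqrtr_ge0.
have t0 i j : (0 <= t i j)%R by rewrite /t; case: ifP => // _; exact: sqrtr_ge0.
pose rho' w := (s (H w) (J' w) * rho w + (if D1 w == n then t (H w) (J' w) else 0))%R.
have mrho' : measurable_fun setT rho'.
  apply: measurable_funD.
    apply: measurable_funM => //; exact: measurable_nat2.
  by apply: measurable_fun_ifT => //; exact: measurable_nat2.
have rho'0 w : (0 <= rho' w)%R.
  by rewrite addr_ge0 ?mulr_ge0//; case: ifP.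
pose C i j := H @^-1` [set i] `&` J' @^-1` [set j].
have mC i j : measurable (C i j) by apply: measurableI; exact: measurable_cell.
have rhoD w : D1 w == n -> rho w = 0%R.
  by move=> /eqP Dn; apply: ub; rewrite Dn.
have CA i j : \int[m]_(w in C i j) (rho w ^+ 2)%:E = (a i j)%:E.
  have [_ <-] := KP i; rewrite [LHS]integral_mkcond [RHS]integral_mkcond.
  apply: eq_integral => w _; rewrite !patchE.
  have [Dn|Dn] := boolP (D1 w == n).
    by rewrite rhoD// expr0n; case: ifP; case: ifP.
  suff -> : (w \in C i j) = (w \in J @^-1` [set i] `&` K i @^-1` [set j]) by [].
  by apply/idP/idP; rewrite !inE /C /H /J'/= (negbTE Dn) => -[-> Kj]; split=> //.
have CB i j : \int[m]_(w in C i j) (rho' w ^+ 2)%:E = (b i j)%:E.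
  have [ap|/negP ap] := boolP (0 < a i j)%R.
    have -> : \int[m]_(w in C i j) (rho' w ^+ 2)%:E =
        \int[m]_(w in C i j) ((b i j / a i j)%:E * (rho w ^+ 2)%:E).
      apply: eq_integral => w; rewrite inE => -[/= Hi Jj].
      rewrite /rho' Hi Jj /s /t ap if_same addr0 exprMn sqr_sqrtr ?EFinM//.
      by rewrite divr_ge0.
    rewrite ge0_integralZl_EFin//; last 3 first.
    - by move=> w _; rewrite lee_fin sqr_ge0.
    - by apply: measurable_funTS; exact: msqr.
    - by rewrite divr_ge0.
    by rewrite CA -EFinM divfK// gt_eqF.
  have -> : \int[m]_(w in C i j) (rho' w ^+ 2)%:E =
      \int[m]_(w in D1 @^-1` [set n] `&` (D2 @^-1` [set i] `&` D3 @^-1` [set j]))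
         (b i j / fr i j)%:E.
    rewrite [LHS]integral_mkcond [RHS]integral_mkcond.
    apply: eq_integral => w _; rewrite !patchE.
    case: ifPn; rewrite ?inE.
      move=> -[/= Hi Jj]; rewrite /rho' Hi Jj /s /t (negbTE (introN idP ap)) mul0r add0r.
      move: Hi Jj; rewrite /H /J'; case: eqP => Dn D2i D3j.
        by rewrite mem_set//= sqr_sqrtr// divr_ge0// ltW.
      by rewrite memNset; [rewrite expr0n|case].
    move=> /negP nC; rewrite memNset// => -[/= Dn [D2i D3j]]; apply: nC.
    by rewrite inE; split; rewrite /= /H /J' Dn eqxx.
  rewrite integral_cst//.
  transitivity ((b i j / fr i j)%:E * (fr i j)%:E); first by rewrite frE.
  by rewrite -EFinM divfK// gt_eqF.
exists J', rho'; split=> //.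
  move=> w nD; rewrite /rho' ub ?mulr0 ?add0r; last exact: ltnW.
  by case: eqP => // Dn; move: nD; rewrite Dn ltnn.
split=> [j|kappa k1].
  apply: (eq_integral_cells (c := H) (c' := I)) => //.
  - exact: measurable_cell.
  - exact: msqr.
  - exact: measurable_cell.
  - exact: msqr.
  - by move=> w; rewrite lee_fin sqr_ge0.
  - by move=> w; rewrite lee_fin sqr_ge0.
  - by move=> i; rewrite setIC CB setIC bE.
rewrite -ge0_integralZl_EFin//; last 2 first.
- by move=> v _; rewrite lee_fin wcost_ge0.
- by apply/measurable_EFinP; apply: measurable_wcost => //; exact: measurable_nat2.
have mcost : measurable_fun setT (fun w => (wcost (rho w) (rho' w) (kappa (J w) (J' w)))%:E).
  by apply/measurable_EFinP; apply: measurable_wcost => //; exact: measurable_nat2.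
have mcost' : measurable_fun setT (fun v => 4%:E * (wcost (r v) (r' v) (kappa (I v) (I' v)))%:E).
  apply: measurable_funeM.
  by apply/measurable_EFinP; apply: measurable_wcost => //; exact: measurable_nat2.
have cost0 w : 0 <= (wcost (rho w) (rho' w) (kappa (J w) (J' w)))%:E.
  by rewrite lee_fin wcost_ge0.
have cost'0 v : 0 <= 4%:E * (wcost (r v) (r' v) (kappa (I v) (I' v)))%:E.
  by rewrite mule_ge0// lee_fin wcost_ge0.
apply: (le_integral_cells (c := H) (c' := I)) => // i; rewrite !setTI.
apply: (le_integral_cells (c := J') (c' := I')) => //; [exact: measurable_cell..|move=> j].
rewrite -/(C i j) -/(cellV i j).
have -> : \int[alpha]_(v in cellV i j) (4%:E * (wcost (r v) (r' v) (kappa (I v) (I' v)))%:E)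
   = 4%:E * \int[alpha]_(v in cellV i j) (wcost (r v) (r' v) (kappa i j))%:E.
  rewrite -ge0_integralZl_EFin//; last 2 first.
  - by move=> v _; rewrite lee_fin wcost_ge0.
  - by apply: measurable_funTS; apply/measurable_EFinP; exact: measurable_wcost.
  by apply: eq_integral => v; rewrite inE => -[/= -> ->].
have := @cost_lower (kappa i j) i j.
have : 0 <= \int[alpha]_(v in cellV i j) (wcost (r v) (r' v) (kappa i j))%:E.
  by apply: integral_ge0 => v _; rewrite lee_fin wcost_ge0.
case: (\int[alpha]_(v in cellV i j) _) => [c||//]; last first.
  by rewrite gt0_muley ?lte_fin// => _ _; exact: leey.
rewrite lee_fin => c0 hc.
apply: (@le_trans _ _ (if (0 < a i j)%R then a i j * wcost 1 (Num.sqrt (b i j / a i j)) (kappa i j) else 2 * b i j)%:E); last first.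
  rewrite -EFinM lee_fin; apply: lumped_cost_le => // u u0.
  by rewrite -lee_fin EFinD; apply: hc.
case: ifPn => ap.
  have -> : \int[m]_(w in C i j) (wcost (rho w) (rho' w) (kappa (J w) (J' w)))%:E =
     \int[m]_(w in C i j) ((wcost 1 (Num.sqrt (b i j / a i j)) (kappa i j))%:E * (rho w ^+ 2)%:E).
    apply: eq_integral => w; rewrite inE => -[/= Hi Jj].
    rewrite -EFinM; congr EFin; rewrite /rho' Hi Jj /s /t ap if_same addr0.
    have [Dn|Dn] := boolP (D1 w == n); first by rewrite rhoD// /wcost; ring.
    by move: Hi; rewrite /H (negbTE Dn) => ->; rewrite /wcost; ring.
  rewrite ge0_integralZl_EFin//; last 3 first.
  - by move=> w _; rewrite lee_fin sqr_ge0.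
  - by apply: measurable_funTS; exact: msqr.
  - by rewrite wcost_ge0// sqrtr_ge0.
  by rewrite CA -EFinM mulrC.
apply: (@le_trans _ _ (\int[m]_(w in C i j) (2%:E * (rho w ^+ 2)%:E + 2%:E * (rho' w ^+ 2)%:E))).
  apply: ge0_le_integral => //.
  - exact: measurable_funTS.
  - by apply: measurable_funTS; apply: emeasurable_funD; apply: measurable_funeM; exact: msqr.
  - by move=> w _; rewrite -!EFinM -EFinD lee_fin wcost_le.
rewrite ge0_integralD//; last 4 first.
- by move=> w _; rewrite -EFinM lee_fin mulr_ge0// sqr_ge0.
- by apply: measurable_funTS; apply: measurable_funeM; exact: msqr.
- by move=> w _; rewrite -EFinM lee_fin mulr_ge0// sqr_ge0.
- by apply: measurable_funTS; apply: measurable_funeM; exact: msqr.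
rewrite !ge0_integralZl_EFin//; last 4 first.
- by move=> w _; rewrite lee_fin sqr_ge0.
- by apply: measurable_funTS; exact: msqr.
- by move=> w _; rewrite lee_fin sqr_ge0.
- by apply: measurable_funTS; exact: msqr.
rewrite CA CB.
have -> : a i j = 0%R by apply/eqP; rewrite eq_le a0 leNgt ap.
by rewrite mule0 add0e.
Qed.

End step.

(** * Quantization of the base points *)

Section discretization.
Context {R : realType} {X : pseudoPMetricType R}.

(** The cost of moving a point of radius [r] is [2 r^2 (1 - cos d)]; it is small near
    the diagonal, so the first admissible point of a dense sequence will do. *)
Lemma small_cost_quantizer : separable X -> exists s : nat -> X, forall eta : R, 0 < eta ->
  exists2 f : X -> nat, measurable_fun setT (f : borel X -> nat) &
    forall x r, cone_cost x r (s (f x)) r <= eta * r ^+ 2.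
Proof.
move=> /separable_seq[s ds]; exists s => eta eta0.
pose A n : set X := [set x | 2 * (1 - cos (dpi x (s n))) < eta].
have cd (y : X) : continuous (fun x => 2 * (1 - cos (dpi x y)) : R).
  move=> x; apply: cvgM; first exact: cvg_cst.
  apply: cvgB; first exact: cvg_cst.
  have cxy : (z, y) @[z --> x] --> (x, y) by apply: cvg_pair; [exact: cvg_id|exact: cvg_cst].
  have cdp := @continuous_dpi R X.
  have h := cvg_comp _ _ cxy (cdp (x, y)).
  by apply: (cvg_comp _ _ h); exact: continuous_cos.
have oA n : open (A n).
  rewrite (_ : A n = (fun x => 2 * (1 - cos (dpi x (s n)))) @^-1` [set t | t < eta]).
    by move/continuousP: (cd (s n)); apply; exact: open_lt.
  by [].
have [||f mf fP] := @first_index _ (borel X) A.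
- by move=> n; apply: borel_open.
- move=> x; have [||n xn] := ds [set y | 2 * (1 - cos (dpi y x)) < eta].
  + rewrite (_ : mkset _ = (fun y => 2 * (1 - cos (dpi y x))) @^-1` [set t | t < eta]).
      by move/continuousP: (cd x); apply; exact: open_lt.
    by [].
  + by exists x; rewrite /= dpi_refl cos0 subrr mulr0.
  by exists n; rewrite /A/= dpi_sym.
exists f => // x r; have [/ltW h _] := fP x.
rewrite cone_costE subrr expr0n add0r.
have -> : 2 * r * r * (1 - cos (dpi x (s (f x)))) =
  (2 * (1 - cos (dpi x (s (f x))))) * r ^+ 2 by ring.
by rewrite ler_wpM2r// sqr_ge0.
Qed.

End discretization.

(** * Limits of random points of the cone *)

Lemma half_powers_small {R : realType} (T e : R) : 0 < e ->
  exists N, forall n, (N <= n)%N -> T / 2 ^+ n < e.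
Proof.
move=> e0; exists (Num.truncn (T / e)).+1 => n Nn.
rewrite ltr_pdivrMr ?exprn_gt0// mulrC -ltr_pdivrMr//.
apply: lt_le_trans (truncnS_gt _) _.
by rewrite -natrX ler_nat; apply: leq_trans Nn (ltnW (ltn_expl n _)).
Qed.

Section cone_complete.
Context {R : realType} {X : completePseudoMetricType R}.

(** Completeness of the cone in polar coordinates. The radii form a Cauchy
    sequence since [(r - s)^2] is at most the cost; if their limit is not the
    vertex, the base points are Cauchy too, by [cos_small]. *)
Lemma cone_complete (x : nat -> X) (r : nat -> R) (T : R) :
  (forall n, 0 <= r n) ->
  (forall n m, (n <= m)%N -> cone_cost (x n) (r n) (x m) (r m) <= T / 2 ^+ n) ->
  exists r' : R, [/\ r @ \oo --> r', 0 <= r' & 0 < r' -> cvg (x @ \oo)].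
Proof.
move=> r0 cT.
have cr : cvg (r @ \oo).
  apply/cauchy_cvgP; apply: cauchy_exP => e e0.
  have [N NP] := half_powers_small T (exprn_gt0 2 e0).
  exists (r N); exists N => // n /= Nn.
  rewrite /ball/= -(ltr_pXn2r (n := 2)) ?nnegrE ?normr_ge0 ?ltW// real_normK ?num_real//.
  apply: le_lt_trans (NP N (leqnn N)); apply: le_trans (cT N n Nn).
  exact: cone_cost_rad.
move/cvg_ex: cr => [r' rr']; exists r'; split=> //.
  rewrite -(cvg_lim _ rr')//; apply: limr_ge; first by apply/cvg_ex; exists r'.
  exact: nearW.
move=> r'0; apply/cauchy_cvgP; apply: cauchy_exP => e e0.
have e'0 : 0 < Num.min e pi by rewrite lt_min e0 pi_gt0.
have [c c0 cP] := cos_small e'0.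
have [N NP] := half_powers_small T (mulr_gt0 c0 (divr_gt0 (exprn_gt0 2 r'0) (ltr0Sn R 1))).
have hr : r' / 2 < r' by rewrite ltr_pdivrMr// ltr_pMr// ltr1n.
have [N' _ N'P] := cvgr_gt _ rr' _ hr.
pose M := maxn N N'; exists (x M); exists M => // n /= Mn.
apply: (@le_ball _ _ _ (Num.min e pi)); first by rewrite ge_min lexx.
apply: ball_dpi; first by rewrite ge_min lexx orbT.
apply: cP; first by rewrite dpi_ge0 dpi_le.
have rM : r' / 2 < r M by apply: N'P; rewrite /= leq_maxr.
have rn : r' / 2 < r n by apply: N'P; rewrite /= (leq_trans (leq_maxr N N')).
have := NP M (leq_maxl _ _) => h1.
have := le_lt_trans (cT M n Mn) h1; rewrite cone_costE.
set t := cos _; have t1 : 0 <= 1 - t by rewrite subr_ge0 cos_le1.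
have := sqr_ge0 (r M - r n) => h2 h3.
have r22 : 0 < r' ^+ 2 / 2 by rewrite divr_gt0// exprn_gt0.
rewrite -(ltr_pM2r r22).
have rr : r' / 2 * (r' / 2) <= r M * r n by apply: ler_pM; rewrite ?divr_ge0 ?ltW.
have : (1 - t) * (r' / 2 * (r' / 2)) <= (1 - t) * (r M * r n) by rewrite ler_wpM2l.
lra.
Qed.

End cone_complete.

Section measurable_cost.
Context {R : realType} {X : pseudoPMetricType R}.
Context {d : measure_display} {W : measurableType d}.

Lemma strongly_measurable_cost (x1 x2 : W -> X) (r t : W -> R) :
  strongly_measurable x1 -> strongly_measurable x2 ->
  measurable_fun setT r -> measurable_fun setT t ->
  measurable_fun setT (fun w => cone_cost (x1 w) (r w) (x2 w) (t w)).
Proof.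
move=> [g1 cg1 g1x] [g2 cg2 g2x] mr mt.
apply: (measurable_fun_cvg (h := fun k w => cone_cost (g1 k w) (r w) (g2 k w) (t w))).
  move=> k; apply: (@measurable_wcost _ _ _ r t (fun w => cos (dpi (g1 k w) (g2 k w)))) => //.
  apply: measurable_countably_valued.
  exact: (@countably_valued_comp _ _ _ _ _ (fun p => cos (dpi p.1 p.2)) (countably_valued_pair (cg1 k) (cg2 k))).
move=> w _; apply: cvg_cone_cost; [exact: g1x|exact: cvg_cst|exact: g2x|exact: cvg_cst].
Qed.

End measurable_cost.

Section limit.
Context {R : realType} {X : completePseudoMetricType R}.
Context {d : measure_display} {W : measurableType d}.
Variables (m : {finite_measure set W -> \bar R}) (s : nat -> X) (xbar : X).
Variables (J : nat -> W -> nat) (rho : nat -> W -> R).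
Hypotheses (mJ : forall k, measurable_fun setT (J k))
  (mrho : forall k, measurable_fun setT (rho k))
  (rho0 : forall k w, 0 <= rho k w).
Local Open Scope ereal_scope.

Let x k w := s (J k w).
Let c k w := cone_cost (x k w) (rho k w) (x k.+1 w) (rho k.+1 w).

(** Iterating [cone_cost_triangle] doubles the weight of the remaining steps each
    time, which the geometric decay of the costs compensates. *)
Lemma telescope_cost w n k :
  (2 ^+ n * cone_cost (x n w) (rho n w) (x (n + k)%N w) (rho (n + k)%N w) <=
   \sum_(n <= i < n + k) 2 ^+ i.+1 * c i w)%R.
Proof.
elim: k n => [|k IH] n.
  by rewrite addn0 cone_cost_refl mulr0 big_geq.
rewrite big_ltn; last by rewrite addnS ltnS leq_addr.
apply: (@le_trans _ _ (2 ^+ n * (2 * (c n w + cone_cost (x n.+1 w) (rho n.+1 w)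
    (x (n + k.+1)%N w) (rho (n + k.+1)%N w)))))%R.
  by rewrite ler_wpM2l ?exprn_ge0// cone_cost_triangle.
have := IH n.+1; rewrite addSnnS => h.
rewrite mulrA -exprSr mulrDr; lra.
Qed.

(** By [telescope_cost] the series [U] bounds [2^n] times the cost between the
    [n]-th and any later random point. Where it is finite the random points
    converge, and elsewhere the bound by [U] says nothing; since [U] is
    integrable, integrating the bound gives a rate. *)
Lemma realization_limit (M : R) : (0 <= M)%R ->
  (forall k, \int[m]_w (c k w)%:E <= (M / 4 ^+ k)%:E) ->
  exists (y : W -> X) (t : W -> R),
   [/\ strongly_measurable y, measurable_fun setT t, (forall w, (0 <= t w)%R) &
     forall n, \int[m]_w (cone_cost (x n w) (rho n w) (y w) (t w))%:E <=
       (4 * M / 2 ^+ n)%:E].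
Proof.
move=> M0 cM.
have c0 k w : (0 <= c k w)%R by exact: cone_cost_ge0.
have sx k : strongly_measurable (x k).
  by apply: countably_valued_strongly; exists (J k), s.
have mc k : measurable_fun setT (c k).
  by apply: strongly_measurable_cost => //; exact: sx.
pose U w := \sum_(k <oo) (2 ^+ k.+1 * c k w)%:E.
have U0 w : 0 <= U w.
  by apply: nneseries_ge0 => k _ _; rewrite lee_fin mulr_ge0.
have mU : measurable_fun setT U.
  apply: ge0_emeasurable_sum => [k w _ _|k _].
    by rewrite lee_fin mulr_ge0.
  by apply/measurable_EFinP; exact: measurable_funM.
have intU : \int[m]_w U w <= (4 * M)%:E.
  rewrite integral_nneseries//; last 2 first.
  - by move=> k; apply/measurable_EFinP; exact: measurable_funM.
  - by move=> k w _; rewrite lee_fin mulr_ge0.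
  apply: le_trans (epsilon_trick0 xpredT (_ : 0 <= 4 * M)%R); last by rewrite mulr_ge0.
  apply: lee_nneseries => [k _ _|k _].
    by apply: integral_ge0 => w _; rewrite lee_fin mulr_ge0.
  under eq_integral do rewrite EFinM.
  rewrite ge0_integralZl_EFin//; last 2 first.
  - by move=> w _; rewrite lee_fin.
  - exact/measurable_EFinP.
  apply: (@le_trans _ _ ((2 ^+ k.+1)%:E * (M / 4 ^+ k)%:E)).
    by apply: lee_wpmul2l; rewrite ?lee_fin ?exprn_ge0//; exact: cM.
  rewrite -EFinM lee_fin natrX (_ : 4 = 2 * 2 :> R)%R; last by ring.
  rewrite exprMn !exprS le_eqVlt; apply/orP; left; apply/eqP; field.
  by rewrite expf_neq0.
have Ubound w n k : (2 ^+ n * cone_cost (x n w) (rho n w) (x (n + k)%N w) (rho (n + k)%N w))%:E <= U w.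
  apply: (@le_trans _ _ (\sum_(0 <= i < n + k) (2 ^+ i.+1 * c i w))%:E)%R.
    rewrite lee_fin; apply: le_trans (telescope_cost w n k) _.
    rewrite [leRHS](big_cat_nat (n := n)) ?leq_addr//= lerDr.
    by apply: sumr_ge0 => i _; rewrite mulr_ge0.
  rewrite -sumEFin; apply: nneseries_lim_ge => i _ _.
  by rewrite lee_fin mulr_ge0.
pose G := [set w | U w < +oo].
have mG : measurable G.
  rewrite -[G]setTI; exact: emeasurable_fun_infty_o.
(* where [U] is infinite the limit is set to the vertex *)
have lim_ex w : exists t : R, (0 <= t)%R /\
    if pselect (G w) is left _ then 
      (fun k => rho k w) @ \oo --> t /\ ((0 < t)%R -> cvg ((fun k => x k w) @ \oo))
    else t = 0%R.
  case: pselect => Gw; last by exists 0%R.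
  have [||t [tt t0 tx]] := @cone_complete R X (x ^~ w) (rho ^~ w) (fine (U w)).
  - by move=> n.
  - move=> n k nk; rewrite ler_pdivlMr ?exprn_gt0// mulrC -lee_fin fineK.
      by rewrite -(subnKC nk); exact: Ubound.
    by rewrite ge0_fin_numE.
  - by exists t.
have /choice[t tP] := lim_ex.
pose P : set W := [set w | G w /\ (0 < t w)%R].
pose y w := if pselect (P w) then lim ((fun k => x k w) @ \oo) else xbar.
have t0 w : (0 <= t w)%R by have [] := tP w.
have mt : measurable_fun setT t.
  apply: (measurable_fun_cvg (h := fun k w => rho k w * \1_G w)%R).
    by move=> k; apply: measurable_funM => //; exact: measurable_indic.
  move=> w _; have [_] := tP w; case: pselect => [Gw [tw _]|nGw ->].
    rewrite -[X in _ --> X]mulr1; apply: cvgM => //.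
    rewrite indicE mem_set//; exact: cvg_cst.
  rewrite -[X in _ --> X](mulr0 1%R); under eq_fun do rewrite indicE memNset// mulr0.
  rewrite mulr0; exact: cvg_cst.
have mP : measurable P.
  rewrite (_ : P = G `&` t @^-1` `]0%R, +oo[); last first.
    by apply/seteqP; split=> w; rewrite /P/= in_itv/= andbT.
  by apply: measurableI => //; rewrite -[X in measurable X]setTI; exact: mt.
have xy w : P w -> (fun k => x k w) @ \oo --> y w.
  move=> Pw; have -> : y w = lim ((fun k => x k w) @ \oo) by rewrite /y; case: pselect.
  by have [_] := tP w; case: Pw => Gw tw; case: pselect => // _ [_ /(_ tw)].
have smy : strongly_measurable y.
  exists (fun k w => if w \in P then x k w else xbar) => [k|w].
    have cP : countably_valued (fun w => (nat_of_bool (w \in P), J k w)).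
      apply: countably_valued_pair; apply: countably_valued_nat => //.
      apply: measurable_fun_nat => i.
      rewrite (_ : _ @^-1` _ = if i == 1%N then P else if i == 0%N then ~` P else set0).
        by case: ifP => // _; case: ifP => // _; exact: measurableC.
      apply/seteqP; split=> [w /= <-|w] /=.
        by case: (boolP (w \in P)) => /=; [rewrite inE|move/negP; rewrite inE].
      by case: i => [|[|i]]//= Pw; [rewrite memNset|rewrite mem_set].
    have -> : (fun w => if w \in P then x k w else xbar) =
        (fun p : nat * nat => if p.1 == 1%N then s p.2 else xbar) \o
        (fun w => (nat_of_bool (w \in P), J k w)).
      by apply/funext => w /=; case: (w \in P).
    exact: countably_valued_comp.
  have [Pw|nPw] := pselect (P w).
    by rewrite mem_set//; exact: xy.
  have -> : y w = xbar by rewrite /y; case: pselect.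
  by rewrite memNset//; exact: cvg_cst.
have costlim w n : G w ->
    (fun k => cone_cost (x n w) (rho n w) (x k w) (rho k w)) @ \oo -->
    cone_cost (x n w) (rho n w) (y w) (t w).
  move=> Gw; have [_] := tP w; case: pselect => // _ [rt _].
  have [tw|tw] := ltP 0%R (t w).
    by apply: cvg_cone_cost => //; [exact: cvg_cst|exact: cvg_cst|exact: xy].
  have tw0 : t w = 0%R by apply/eqP; rewrite eq_le tw t0.
  rewrite tw0 cone_cost0; rewrite tw0 in rt.
  have h' (e : R) : (fun k => rho n w ^+ 2 + (rho k w * rho k w + e * rho k w))%R @ \oo -->
      (rho n w ^+ 2 + (0 * 0 + e * 0))%R.
    apply: cvgD; first exact: cvg_cst.
    apply: cvgD; apply: cvgM => //; exact: cvg_cst.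
  have h (e : R) : (fun k => rho n w ^+ 2 + (rho k w * rho k w + e * rho k w))%R @ \oo -->
      (rho n w ^+ 2)%R.
    by have := h' e; rewrite !mulr0 !addr0.
  apply: (squeeze_cvgr _ (h (- (2 * rho n w))%R) (h (2 * rho n w)%R)).
  apply: nearW => k; rewrite /cone_cost /cosine_law.
  have := cos_geN1 (dpi (x n w) (x k w)); have := cos_le1 (dpi (x n w) (x k w)).
  have : (0 <= rho n w * rho k w)%R by rewrite mulr_ge0.
  move: (cos _) => u; nra.
exists y, t; split=> // n.
have costU w : (2 ^+ n * cone_cost (x n w) (rho n w) (y w) (t w))%:E <= U w.
  have [Gw|] := pselect (G w); last first.
    by move=> /negP; rewrite -leNgt leye_eq => /eqP ->; exact: leey.
  have Ufin : U w \is a fin_num by rewrite ge0_fin_numE.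
  rewrite -(fineK Ufin) lee_fin mulrC -ler_pdivlMr ?exprn_gt0//.
  rewrite -(cvg_lim _ (costlim w n Gw))//; apply: limr_le.
    by apply/cvg_ex; eexists; exact: costlim.
  exists n => // k /= nk; rewrite ler_pdivlMr ?exprn_gt0// mulrC -lee_fin fineK//.
  by rewrite -(subnKC nk); exact: Ubound.
have mcost : measurable_fun setT (fun w => cone_cost (x n w) (rho n w) (y w) (t w)).
  by apply: strongly_measurable_cost => //; exact: sx.
have : (2 ^+ n)%:E * \int[m]_w (cone_cost (x n w) (rho n w) (y w) (t w))%:E <= (4 * M)%:E.
  rewrite -ge0_integralZl_EFin//; last 2 first.
  - by move=> w _; rewrite lee_fin cone_cost_ge0.
  - exact/measurable_EFinP.
  apply: le_trans intU; apply: ge0_le_integral => //.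
    by move=> w _; rewrite -EFinM lee_fin mulr_ge0 ?cone_cost_ge0.
    by apply: measurable_funeM; exact/measurable_EFinP.
  by move=> w _; rewrite -EFinM.
have -> : (4 * M / 2 ^+ n)%:E = (4 * M)%:E * ((2 ^+ n)^-1)%:E by [].
by rewrite lee_pdivlMr ?exprn_gt0// muleC.
Qed.

End limit.

(** * The chain of plans on one space *)

Lemma dependent_seq {T : Type} (P : nat -> T -> Prop) (Q : nat -> T -> T -> Prop) :
  (exists x, P 0%N x) ->
  (forall n x, P n x -> exists y, P n.+1 y /\ Q n x y) ->
  exists u : nat -> T, (forall n, P n (u n)) /\ forall n, Q n (u n) (u n.+1).
Proof.
move=> [x0 Px0] PQ.
have /choice[F FP] : forall p : nat * T, exists y,
    P p.1 p.2 -> P p.1.+1 y /\ Q p.1 p.2 y.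
  move=> [n x]; have [/PQ[y ?]|nP] := pselect (P n x); first by exists y.
  by exists x.
pose u := fix u n := if n is k.+1 then F (k, u k) else x0.
have Pu n : P n (u n) by elim: n => [//|n IH]; have [] := FP (n, u n) IH.
by exists u; split=> // n; have [] := FP (n, u n) (Pu n).
Qed.

Lemma sqr_half_power {R : realType} k : (2 ^- k ^+ 2 = 4 ^- k :> R).
Proof. by rewrite exprVn -exprM mulnC exprM (_ : 2 ^+ 2 = 4 :> R)//; ring. Qed.

Section chain.
Context {R : realType} {X : completePseudoMetricType R}.
Hypothesis sepX : separable X.
Variable s : nat -> X.
Local Open Scope ereal_scope.

(** Moving every point [x] of [mu] to [s (f x)] at constant radius costs at most
    [e]; the pointwise form makes the bound independent of how [mu] is realized
    on the cone. *)
Definition quantizes (f : X -> nat) (mu : set X -> \bar R) (e : R) :=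
  measurable_fun setT (f : borel X -> nat) /\
  exists eta : R, [/\ (0 < eta)%R, (eta * fine (mu setT) <= e)%R &
    forall x r, (cone_cost x r (s (f x)) r <= eta * r ^+ 2)%R].

Lemma quantizes_cell {d} {W : measurableType d}
  (m : {finite_measure set W -> \bar R}) (x : W -> X) (r : W -> R)
  (mu : radon_measure R X) f e i :
  quantizes f mu e -> realizes m x r mu ->
  \int[m]_(w in (f \o x) @^-1` [set i]) (r w ^+ 2)%:E = mu (f @^-1` [set i]).
Proof. by move=> [mf _] rx; rewrite comp_preimage rx//; exact: measurable_cell. Qed.

Lemma strongly_measurable_quantize {d} {W : measurableType d} (x : W -> X)
  (f : X -> nat) : measurable_fun setT (f : borel X -> nat) ->
  measurable_fun setT (x : W -> borel X) ->
  measurable_fun setT (f \o x) /\ strongly_measurable (fun w => s (f (x w))).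
Proof.
move=> mf mx; have mfx : measurable_fun setT (f \o x) by exact: (measurableT_comp mf mx).
split=> //; apply: countably_valued_strongly; by exists (f \o x), s.
Qed.

Lemma quantizes_cost {d} {W : measurableType d}
  (m : {finite_measure set W -> \bar R}) (x : W -> X) (r : W -> R)
  (mu : radon_measure R X) f e :
  quantizes f mu e -> realizes m x r mu ->
  measurable_fun setT (x : W -> borel X) -> measurable_fun setT r ->
  \int[m]_w (cone_cost (x w) (r w) (s (f (x w))) (r w))%:E <= e%:E.
Proof.
move=> [mf [eta [eta0 etae fP]]] rx mx mr.
have [_ sfx] := strongly_measurable_quantize mf mx.
have sx := borel_strongly_measurable sepX mx.
apply: (@le_trans _ _ (\int[m]_w (eta%:E * (r w ^+ 2)%:E))).
  apply: ge0_le_integral => //.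
  - by move=> w _; rewrite lee_fin cone_cost_ge0.
  - by apply/measurable_EFinP; exact: strongly_measurable_cost.
  - by apply: measurable_funeM; apply/measurable_EFinP; exact: measurable_funX.
  - by move=> w _; rewrite -EFinM lee_fin.
rewrite ge0_integralZl_EFin//; last 3 first.
- by move=> w _; rewrite lee_fin sqr_ge0.
- by apply/measurable_EFinP; exact: measurable_funX.
- exact: ltW.
have := rx setT measurableT; rewrite preimage_setT => ->.
by rewrite -(fineK (_ : mu setT \is a fin_num)) ?fin_num_measure// -EFinM lee_fin.
Qed.

Lemma cone_cost_4 (x y z w : X) (a b c d : R) :
  (0 <= a -> 0 <= b -> 0 <= c -> 0 <= d ->
  cone_cost x a w d <= 4 * (cone_cost x a y b + cone_cost y b z c + cone_cost z c w d))%R.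
Proof.
move=> a0 b0 c0 d0.
have := cone_cost_triangle x y w a0 b0 d0.
have := cone_cost_triangle y z w b0 c0 d0.
have := cone_cost_ge0 x a y b; lra.
Qed.

Variables (xbar : X) (v : nat -> radon_measure R X) (f : nat -> X -> nat).
Hypotheses (qf : forall k, quantizes (f k) (v k) (4 ^- k)%R)
  (HKv : forall k, HK xbar (v k) (v k.+1) < (2 ^- k)%:E).

(** The measures [v k], with their base points quantized, are realized by random
    points on one and the same space, so that consecutive ones are close. Since
    the quantized plan has discrete marginals, conditioning on the present
    state is elementary, and [follow_plan] extends the realization step by
    step. The first measure is created from nothing, by following the plan that
    joins the zero measure to it. The constant is [4 * 4 * 3]: one factor [4] is
    lost in [follow_plan], one in [cone_cost_4], and [3] bounds the three
    terms. *)
Lemma chain_realization : exists (m : {finite_measure set R -> \bar R})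
    (J : nat -> R -> nat) (rho : nat -> R -> R),
  [/\ 0 < m setT,
      forall k, measurable_fun setT (J k) /\ measurable_fun setT (rho k),
      (forall k w, 0 <= rho k w)%R,
      forall k i, \int[m]_(w in J k @^-1` [set i]) (rho k w ^+ 2)%:E =
                  v k (f k @^-1` [set i]) &
      forall k, \int[m]_w (cone_cost (s (J k w)) (rho k w)
                          (s (J k.+1 w)) (rho k.+1 w))%:E <= (48 / 4 ^+ k)%:E].
Proof.
have [m [N [m0 mN N0]]] := @reference_measure R.
(* each region [N = k] encodes a time and a cell of the plan used at that time *)
pose D w := odflt (0, 0, 0)%N (unpickle (N w) : option (nat * nat * nat)).
have mD (g : nat * nat * nat -> nat) : measurable_fun setT (fun w => g (D w)).
  exact: (@measurable_nat2 _ _ _ _ (fun n _ => g (odflt (0, 0, 0)%N (unpickle n))) N N).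
pose D1 w := (D w).1.1; pose D2 w := (D w).1.2; pose D3 w := (D w).2.
have mD1 : measurable_fun setT D1 by exact: (mD (fun p => p.1.1)).
have mD2 : measurable_fun setT D2 by exact: (mD (fun p => p.1.2)).
have mD3 : measurable_fun setT D3 by exact: (mD (fun p => p.2)).
have D0 n i j : 0 < m (D1 @^-1` [set n] `&` (D2 @^-1` [set i] `&` D3 @^-1` [set j])).
  apply: lt_le_trans (N0 (pickle (n, i, j))) _; apply: le_measure; rewrite ?inE.
  - exact: measurable_cell.
  - by apply: measurableI; [|apply: measurableI]; exact: measurable_cell.
  - by move=> w /= Nw; rewrite /D1 /D2 /D3 /D Nw pickleK.
pose P k (u : (R -> nat) * (R -> R)) :=
  [/\ measurable_fun setT u.1, measurable_fun setT u.2, (forall w, 0 <= u.2 w)%R,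
      unborn D1 k.+1 u.2 &
      forall i, \int[m]_(w in u.1 @^-1` [set i]) (u.2 w ^+ 2)%:E =
                v k (f k @^-1` [set i])].
pose Q k (u u' : (R -> nat) * (R -> R)) :=
  \int[m]_w (cone_cost (s (u.1 w)) (u.2 w) (s (u'.1 w)) (u'.2 w))%:E
    <= (48 / 4 ^+ k)%:E.
have [||u [uP uQ]] := @dependent_seq _ P Q.
- have mf0 : measurable_fun setT (f 0%N : borel X -> nat) by have [] := qf 0%N.
  have m00 : measurable_fun setT (fun _ : borel X => 0%R : R) by [].
  have m01 : measurable_fun setT (fun _ : borel X => 1%R : R) by [].
  have roo : \int[v 0%N]_x ((fun _ : borel X => 0%R : R) x ^+ 2)%:E < +oo.
    by under eq_integral do rewrite expr0n; rewrite integral0.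
  have r'oo : \int[v 0%N]_x ((fun _ : borel X => 1%R : R) x ^+ 2)%:E < +oo.
    under eq_integral do rewrite expr1n.
    by rewrite integral_cst// mul1e ltey_eq fin_num_measure.
  have ub0 : unborn D1 0%N (fun _ : R => 0%R : R) by [].
  have marg0 i : \int[m]_(w in (fun _ : R => 0%N) @^-1` [set i]) (((fun _ : R => 0%R : R)) w ^+ 2)%:E =
      \int[v 0%N]_(x in (fun _ : borel X => 0%N) @^-1` [set i]) ((fun _ : borel X => 0%R : R) x ^+ 2)%:E.
    under eq_integral do rewrite expr0n; rewrite integral0.
    by under eq_integral do rewrite expr0n; rewrite integral0.
  have [J [rho [mJ mrho rho0 ub [marg _]]]] := follow_plan (measurable_cst 0%N) mf0 m00 m01
    (fun=> lexx 0%R) (fun=> ler01) roo r'oo m0 mD1 mD2 mD3 D0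
    (measurable_cst 0%N) (measurable_cst (0%R : R)) (fun=> lexx 0%R) ub0 marg0.
  exists (J, rho); split=> //= i; rewrite marg.
  under eq_integral do rewrite expr1n.
  by rewrite integral_cst ?mul1e//; exact: measurable_cell.
- move=> k [J rho] [/= mJ mrho rho0 ub marg].
  have k0 : (0 < 2 ^- k :> R)%R by rewrite invr_gt0 exprn_gt0.
  have [alpha [re1 re2 cost]] := HK_lt_realize k0 (HKv k).
  have [mfk _] := qf k; have [mfk1 _] := qf k.+1.
  have [mx1 mx2 mr1 mr2] := measurable_cone_maps xbar.
  have [mI1 sI1] := strongly_measurable_quantize mfk mx1.
  have [mI2 sI2] := strongly_measurable_quantize mfk1 mx2.
  have rad0 (pr : cone X * cone X -> cone X) p : (0 <= (@cone_rad R X \o pr) p)%R by exact: cone_rad_ge0.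
  have marg' i : \int[m]_(w in J @^-1` [set i]) (rho w ^+ 2)%:E =
    \int[alpha]_(p in (f k \o (cone_pt xbar \o fst)) @^-1` [set i]) (((@cone_rad R X \o fst) p) ^+ 2)%:E.
    by rewrite marg; apply/esym; exact: quantizes_cell (qf k) re1.
  have [J' [rho' [mJ' mrho' rho'0 ub' [marg2 cost']]]] := follow_plan mI1 mI2 mr1 mr2
    (rad0 fst) (rad0 snd) (realizes_setT re1) (realizes_setT re2)
    m0 mD1 mD2 mD3 D0 mJ mrho rho0 ub marg'.
  exists (J', rho'); split.
    split=> //= i; rewrite marg2; exact: quantizes_cell (qf k.+1) re2.
  rewrite /Q/=.
  have kap i j : (-1 <= cos (dpi (s i) (s j)) <= 1)%R by rewrite cos_geN1 cos_le1.
  apply: le_trans (cost' _ kap) _.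
  have sx1 := borel_strongly_measurable sepX mx1.
  have sx2 := borel_strongly_measurable sepX mx2.
  set x1 := cone_pt xbar \o fst in re1 mx1 mI1 sI1 sx1 *.
  set x2 := cone_pt xbar \o snd in re2 mx2 mI2 sI2 sx2 *.
  set r1 := cone_rad \o fst in re1 mr1 *.
  set r2 := cone_rad \o snd in re2 mr2 *.
  have c1 := quantizes_cost (qf k) re1 mx1 mr1.
  have c2 := quantizes_cost (qf k.+1) re2 mx2 mr2.
  have mc1 : measurable_fun setT (fun p : borel (cone X * cone X)%type => (cone_cost (s (f k (x1 p))) (r1 p) (x1 p) (r1 p))%:E).
    by apply/measurable_EFinP; exact: strongly_measurable_cost.
  have mc : measurable_fun setT (fun p : borel (cone X * cone X)%type => (cone_cost (x1 p) (r1 p) (x2 p) (r2 p))%:E).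
    by apply/measurable_EFinP; exact: strongly_measurable_cost.
  have mc2 : measurable_fun setT (fun p : borel (cone X * cone X)%type => (cone_cost (x2 p) (r2 p) (s (f k.+1 (x2 p))) (r2 p))%:E).
    by apply/measurable_EFinP; exact: strongly_measurable_cost.
  have cg0 (y1 : X) (t1 : R) (y2 : X) (t2 : R) : 0 <= (cone_cost y1 t1 y2 t2)%:E.
    by rewrite lee_fin cone_cost_ge0.
  apply: (@le_trans _ _ (4%:E * \int[alpha]_p (4%:E * ((cone_cost (s (f k (x1 p))) (r1 p) (x1 p) (r1 p))%:E
      + (cone_cost (x1 p) (r1 p) (x2 p) (r2 p))%:E
      + (cone_cost (x2 p) (r2 p) (s (f k.+1 (x2 p))) (r2 p))%:E)))).
    apply: lee_wpmul2l; first by rewrite lee_fin.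
    apply: ge0_le_integral => //.
    + by move=> p _; exact: cg0.
    + by apply/measurable_EFinP; exact: (strongly_measurable_cost sI1 sI2).
    + by apply: measurable_funeM; do 2 apply: emeasurable_funD => //.
    + move=> p _; rewrite -!EFinD -EFinM lee_fin.
      by apply: cone_cost_4; exact: cone_rad_ge0.
  rewrite ge0_integralZl_EFin//; last 2 first.
  + by move=> p _; rewrite !adde_ge0.
  + by do 2 apply: emeasurable_funD => //.
  rewrite ge0_integralD//; last 2 first.
  + by move=> p _; rewrite adde_ge0.
  + exact: emeasurable_funD.
  rewrite ge0_integralD//.
  have {}c1 : \int[alpha]_p (cone_cost (s (f k (x1 p))) (r1 p) (x1 p) (r1 p))%:E <= (4 ^- k)%:E.
    by under eq_integral do rewrite cone_costC.
  rewrite sqr_half_power in cost.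
  have := leeD (leeD c1 (ltW cost)) c2; rewrite -!EFinD => h.
  rewrite muleA -EFinM.
  apply: (@le_trans _ _ ((4 * 4)%:E * (4 ^- k + 4 ^- k + 4 ^- k.+1)%:E)).
    by apply: lee_wpmul2l => //; rewrite lee_fin mulr_ge0.
  rewrite -EFinM lee_fin exprS invfM.
  have : (0 <= 4 ^- k :> R)%R by rewrite invr_ge0 exprn_ge0.
  lra.
exists m, (fun k => (u k).1), (fun k => (u k).2).
split; last exact: uQ.
- apply: lt_le_trans (N0 0%N) _; apply: le_measure; rewrite ?inE//.
  exact: measurable_cell.
- by move=> k; have [] := uP k.
- by move=> k; have [] := uP k.
- by move=> k; have [] := uP k.
Qed.

End chain.

(** * Gluing two realizations along a quantized measure *)

Section unit_weight.
Context {R : realType} {d : measure_display} {W : measurableType d}.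
Variables (m : {finite_measure set W -> \bar R}) (J : W -> nat) (t : W -> R)
  (nu : nat -> R).
Hypotheses (mT : (0 < m setT)%E) (mJ : measurable_fun setT J)
  (mt : measurable_fun setT t) (t0 : forall w, 0 <= t w)
  (nuE : forall i, (\int[m]_(w in J @^-1` [set i]) (t w ^+ 2)%:E = (nu i)%:E)%E).
Local Open Scope ereal_scope.

(** The factor by which a radius in state [i] is dilated when the point is
    coupled with [w]. Its square has integral [1] over [W], so the dilation
    leaves homogeneous marginals unchanged: points in state [i] only meet [w]
    with [J w = i], weighted by the mass [t w ^+ 2] relative to the mass [nu i]
    of the state. A state without mass is coupled uniformly with all of [W]. *)
Definition unit_weight (i : nat) (w : W) : R :=
  (if (0 < nu i)%R then (if J w == i then t w / Num.sqrt (nu i) else 0)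
   else (Num.sqrt (fine (m setT)))^-1)%R.

Lemma unit_weight_ge0 i w : (0 <= unit_weight i w)%R.
Proof.
rewrite /unit_weight; case: ifP => _; last by rewrite invr_ge0 sqrtr_ge0.
by case: ifP => // _; rewrite divr_ge0 ?sqrtr_ge0.
Qed.

Lemma integral_unit_weight i : \int[m]_w (unit_weight i w ^+ 2)%:E = 1.
Proof.
have [nui|nui] := boolP (0 < nu i)%R.
  have -> : \int[m]_w (unit_weight i w ^+ 2)%:E =
     \int[m]_(w in J @^-1` [set i]) ((nu i)^-1%:E * (t w ^+ 2)%:E).
    rewrite [RHS]integral_mkcond; apply: eq_integral => w _.
    rewrite patchE /unit_weight nui; have [Ji|Ji] := eqVneq (J w) i.
      by rewrite mem_set// exprMn exprVn sqr_sqrtr ?ltW// mulrC EFinM.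
    by rewrite memNset ?expr0n//=; exact/eqP.
  rewrite ge0_integralZl_EFin//; last 4 first.
  - exact: measurable_cell.
  - by move=> w _; rewrite lee_fin sqr_ge0.
  - by apply: measurable_funTS; apply/measurable_EFinP; exact: measurable_funX.
  - by rewrite invr_ge0 ltW.
  by rewrite nuE -EFinM mulVf// gt_eqF.
under eq_integral do rewrite /unit_weight (negbTE nui).
have fin : m setT \is a fin_num by rewrite fin_num_measure.
have c0 : (0 < fine (m setT))%R by rewrite -lte_fin fineK.
rewrite integral_cst// exprVn sqr_sqrtr ?ltW//.
transitivity ((fine (m setT))^-1%:E * (fine (m setT))%:E); first by rewrite fineK.
by rewrite -EFinM mulVf// gt_eqF.
Qed.

Lemma measurable_unit_weight {d'} {V : measurableType d'} (i : V -> nat) (w : V -> W) :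
  measurable_fun setT i -> measurable_fun setT w ->
  measurable_fun setT (fun v => unit_weight (i v) (w v)).
Proof.
move=> mi mw.
pose h (k j : nat) : R := (if (0 < nu k)%R then (if j == k then (Num.sqrt (nu k))^-1 else 0) else 0)%R.
pose g (k j : nat) : R := (if (0 < nu k)%R then 0 else (Num.sqrt (fine (m setT)))^-1)%R.
have mJw : measurable_fun setT (J \o w) by exact: measurableT_comp.
rewrite (_ : (fun v => _) = (fun v => h (i v) (J (w v)) * t (w v) + g (i v) (J (w v)))%R).
  apply: measurable_funD; last exact: (measurable_nat2 g mi mJw).
  apply: measurable_funM; first exact: (measurable_nat2 h mi mJw).
  exact: (measurableT_comp mt mw).
apply/funext => v; rewrite /unit_weight /h /g; case: ifP => _; last by rewrite mul0r add0r.
by case: ifP => _; rewrite ?mul0r addr0// mulrC.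
Qed.

End unit_weight.

Section product_integrals.
Context {R : realType} {d1 d2 : measure_display} {W1 : measurableType d1}
  {W2 : measurableType d2}.
Variables (m1 : {finite_measure set W1 -> \bar R})
  (m2 : {finite_measure set W2 -> \bar R}).
Local Open Scope ereal_scope.

Lemma finite_product : exists M : {finite_measure set (W1 * W2)%type -> \bar R},
  forall D (f : W1 * W2 -> \bar R), \int[M]_(z in D) f z = \int[m1 \x m2]_(z in D) f z.
Proof.
have [|M ME] := @finite_measure_of R _ _ (m1 \x m2).
  apply: (@le_lt_trans _ _ (m1 setT * m2 setT)).
    by rewrite -product_measure1E// setXTT.
  by rewrite ltey_eq fin_numM ?fin_num_measure.
exists M => D f; apply: eq_measure_integral => A mA _; exact: ME.
Qed.

Lemma integral_product_weight1 (f : W1 -> \bar R) (e : W1 * W2 -> R) :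
  measurable_fun setT f -> (forall p, 0 <= f p) -> measurable_fun setT e ->
  (forall p, \int[m2]_w (e (p, w) ^+ 2)%:E = 1) ->
  \int[m1 \x m2]_z (f z.1 * (e z ^+ 2)%:E) = \int[m1]_p f p.
Proof.
move=> mf f0 me e1; rewrite fubini_tonelli1//; last 2 first.
- apply: emeasurable_funM; first exact: (measurableT_comp mf measurable_fst).
  by apply/measurable_EFinP; exact: measurable_funX.
- by move=> z; rewrite mule_ge0// lee_fin sqr_ge0.
apply: eq_integral => p _; rewrite /fubini_F/= ge0_integralZl//.
- by rewrite e1 mule1.
- apply/measurable_EFinP; apply: measurable_funX.
  exact: (measurableT_comp me (measurable_pair1 p)).
- by move=> w _; rewrite lee_fin sqr_ge0.
Qed.

Lemma integral_product_weight2 (f : W2 -> \bar R) (e : W1 * W2 -> R) :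
  measurable_fun setT f -> (forall p, 0 <= f p) -> measurable_fun setT e ->
  (forall w, \int[m1]_p (e (p, w) ^+ 2)%:E = 1) ->
  \int[m1 \x m2]_z (f z.2 * (e z ^+ 2)%:E) = \int[m2]_w f w.
Proof.
move=> mf f0 me e1; rewrite fubini_tonelli2//; last 2 first.
- apply: emeasurable_funM; first exact: (measurableT_comp mf measurable_snd).
  by apply/measurable_EFinP; exact: measurable_funX.
- by move=> z; rewrite mule_ge0// lee_fin sqr_ge0.
apply: eq_integral => w _; rewrite /fubini_G/= ge0_integralZl//.
- by rewrite e1 mule1.
- apply/measurable_EFinP; apply: measurable_funX.
  exact: (measurableT_comp me (measurable_pair2 w)).
- by move=> p _; rewrite lee_fin sqr_ge0.
Qed.

End product_integrals.

Section null_cells.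
Context {R : realType} {d : measure_display} {W : measurableType d}.
Local Open Scope ereal_scope.

(** The states without mass do not contribute, although they may occur. *)
Lemma integral_null_cells (m : {measure set W -> \bar R}) (J : W -> nat)
    (t : W -> R) (nu : nat -> R) :
  measurable_fun setT J -> measurable_fun setT t ->
  (forall i, \int[m]_(w in J @^-1` [set i]) (t w ^+ 2)%:E = (nu i)%:E) ->
  \int[m]_w (if (0 < nu (J w))%R then 0 else t w ^+ 2)%:E = 0.
Proof.
move=> mJ mt nuE.
have mf : measurable_fun setT (fun w => (if (0 < nu (J w))%R then 0 else t w ^+ 2)%:E : \bar R).
  apply/measurable_EFinP; apply: measurable_fun_ifT => //; last exact: measurable_funX.
  exact: (measurable_nat2 (fun i _ => (0 < nu i)%R) mJ mJ).
rewrite (integral_cells _ mJ)//; last by move=> w; rewrite lee_fin; case: ifP => // _; exact: sqr_ge0.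
apply: eseries0 => i _ _; rewrite setTI.
have nu0 : (0 <= nu i)%R.
  by rewrite -lee_fin -nuE; apply: integral_ge0 => w _; rewrite lee_fin sqr_ge0.
have [nui|nui] := boolP (0 < nu i)%R.
  have -> : 0 = \int[m]_(w in J @^-1` [set i]) (cst 0 w) by rewrite integral0.
  by apply: eq_integral => w; rewrite inE => /= ->; rewrite nui.
have -> : 0 = (nu i)%:E by congr EFin; apply/eqP; rewrite eq_le nu0 leNgt nui.
by rewrite -nuE; apply: eq_integral => w; rewrite inE => /= ->; rewrite (negbTE nui).
Qed.

End null_cells.

Section gluing.
Context {R : realType} {X : completePseudoMetricType R}.
Hypothesis sepX : separable X.
Context {d1 d2 : measure_display} {W1 : measurableType d1} {W2 : measurableType d2}.
Variables (m1 : {finite_measure set W1 -> \bar R})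
  (m2 : {finite_measure set W2 -> \bar R}) (s : nat -> X).
Variables (x1 : W1 -> X) (r1 : W1 -> R) (K : W1 -> nat) (r : W1 -> R).
Variables (J : W2 -> nat) (t : W2 -> R) (x2 : W2 -> X) (r2 : W2 -> R).
Hypotheses (m1T : (0 < m1 setT)%E) (m2T : (0 < m2 setT)%E)
  (sx1 : strongly_measurable x1) (sx2 : strongly_measurable x2)
  (mK : measurable_fun setT K) (mJ : measurable_fun setT J)
  (mr1 : measurable_fun setT r1) (mr : measurable_fun setT r)
  (mt : measurable_fun setT t) (mr2 : measurable_fun setT r2)
  (r10 : forall p, 0 <= r1 p) (r0 : forall p, 0 <= r p)
  (t0 : forall w, 0 <= t w) (r20 : forall w, 0 <= r2 w).
Variables (xbar : X) (mu1 mu2 mu : radon_measure R X) (f : X -> nat).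
Hypotheses (re1 : realizes m1 x1 r1 mu1) (re2 : realizes m2 x2 r2 mu2)
  (mf : measurable_fun setT (f : borel X -> nat))
  (midK : forall i, (\int[m1]_(p in K @^-1` [set i]) (r p ^+ 2)%:E = mu (f @^-1` [set i]))%E)
  (midJ : forall i, (\int[m2]_(w in J @^-1` [set i]) (t w ^+ 2)%:E = mu (f @^-1` [set i]))%E).
Local Open Scope ereal_scope.

Let nu i := fine (mu (f @^-1` [set i])).
Let nuE i : (nu i)%:E = mu (f @^-1` [set i]).
Proof. by rewrite fineK// fin_num_measure//; exact: measurable_cell. Qed.

Let nuK i : \int[m1]_(p in K @^-1` [set i]) (r p ^+ 2)%:E = (nu i)%:E.
Proof. by rewrite nuE. Qed.
Let nuJ i : \int[m2]_(w in J @^-1` [set i]) (t w ^+ 2)%:E = (nu i)%:E.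
Proof. by rewrite nuE. Qed.

Let e1 (z : W1 * W2) := unit_weight m2 J t nu (K z.1) z.2.
Let e2 (z : W1 * W2) := unit_weight m1 K r nu (J z.2) z.1.

Let me1 : measurable_fun setT e1.
Proof.
apply: measurable_unit_weight => //; exact: (measurableT_comp mK measurable_fst).
Qed.

Let me2 : measurable_fun setT e2.
Proof.
apply: measurable_unit_weight => //; exact: (measurableT_comp mJ measurable_snd).
Qed.

Let e10 z : (0 <= e1 z)%R. Proof. exact: unit_weight_ge0. Qed.
Let e20 z : (0 <= e2 z)%R. Proof. exact: unit_weight_ge0. Qed.

Let c1 p := cone_cost (x1 p) (r1 p) (s (K p)) (r p).
Let c2 w := cone_cost (s (J w)) (t w) (x2 w) (r2 w).
Let n1 p : R := if (0 < nu (K p))%R then 0%R else (r p ^+ 2)%R.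
Let n2 w : R := if (0 < nu (J w))%R then 0%R else (t w ^+ 2)%R.

Let glued_cost z :
  (cone_cost (x1 z.1) (e1 z * r1 z.1) (x2 z.2) (e2 z * r2 z.2) <=
   4 * ((c1 z.1 + n1 z.1) * e1 z ^+ 2 + (c2 z.2 + n2 z.2) * e2 z ^+ 2))%R.
Proof.
case: z => p w /=.
have c10 : (0 <= c1 p)%R by exact: cone_cost_ge0.
have c20 : (0 <= c2 w)%R by exact: cone_cost_ge0.
have n10 : (0 <= n1 p)%R by rewrite /n1; case: ifP => // _; exact: sqr_ge0.
have n20 : (0 <= n2 w)%R by rewrite /n2; case: ifP => // _; exact: sqr_ge0.
have E10 := e10 (p, w); have E20 := e20 (p, w).
have [/andP[/eqP KJ nuKp]|bad] := boolP ((K p == J w) && (0 < nu (K p))%R).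
  have sn : (0 < Num.sqrt (nu (K p)))%R by rewrite sqrtr_gt0.
  have E1 : e1 (p, w) = (t w / Num.sqrt (nu (K p)))%R.
    by rewrite /e1 /unit_weight /= nuKp KJ eqxx.
  have E2 : e2 (p, w) = (r p / Num.sqrt (nu (K p)))%R.
    by rewrite /e2 /unit_weight /= -KJ nuKp eqxx.
  have := @cone_cost_triangle R X (x1 p) (e1 (p, w) * r1 p) (s (K p)) (e1 (p, w) * r p)
    (x2 w) (e2 (p, w) * r2 w) (mulr_ge0 E10 (r10 p)) (mulr_ge0 E10 (r0 p)) (mulr_ge0 E20 (r20 w)).
  have -> : (e1 (p, w) * r p = e2 (p, w) * t w)%R by rewrite E1 E2; ring.
  rewrite {1}(_ : e2 (p, w) * t w = e1 (p, w) * r p)%R; last by rewrite E1 E2; ring.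
  rewrite !cone_costZ KJ -/(c2 w) -KJ -/(c1 p).
  have := sqr_ge0 (e1 (p, w)); have := sqr_ge0 (e2 (p, w)); nra.
have h1 : (e1 (p, w) ^+ 2 * r1 p ^+ 2 <= 2 * ((c1 p + n1 p) * e1 (p, w) ^+ 2))%R.
  rewrite /n1; have [nuKp|nuKp] := boolP (0 < nu (K p))%R.
    have -> : e1 (p, w) = 0%R.
      rewrite /e1 /unit_weight/= nuKp; case: eqP => // JK.
      by move: bad; rewrite nuKp JK eqxx.
    by rewrite expr0n/= mul0r !mulr0.
  have := cone_cost_rad (x1 p) (s (K p)) (r10 p) (r0 p); rewrite -/(c1 p) => h.
  have : (r1 p ^+ 2 <= 2 * (c1 p + r p ^+ 2))%R by have := sqr_ge0 (r1 p - 2 * r p)%R; nra.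
  have := sqr_ge0 (e1 (p, w)); nra.
have h2 : (e2 (p, w) ^+ 2 * r2 w ^+ 2 <= 2 * ((c2 w + n2 w) * e2 (p, w) ^+ 2))%R.
  rewrite /n2; have [nuJw|nuJw] := boolP (0 < nu (J w))%R.
    have -> : e2 (p, w) = 0%R.
      rewrite /e2 /unit_weight/= nuJw; case: eqP => // KJ.
      by move: bad; rewrite KJ nuJw eqxx.
    by rewrite expr0n/= mul0r !mulr0.
  have := cone_cost_rad (s (J w)) (x2 w) (t0 w) (r20 w); rewrite -/(c2 w) => h.
  have : (r2 w ^+ 2 <= 2 * (c2 w + t w ^+ 2))%R by have := sqr_ge0 (r2 w - 2 * t w)%R; nra.
  have := sqr_ge0 (e2 (p, w)); nra.
apply: le_trans (cone_cost_le _ _ (mulr_ge0 E10 (r10 p)) (mulr_ge0 E20 (r20 w))) _.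
rewrite !exprMn; lra.
Qed.

(** Both spaces carry a realization of the same quantized measure, [(s \o K, r)]
    and [(s \o J, t)]. On the product space, points of the two spaces in the
    same state are coupled: the radii of the pair over [p] are multiplied by
    [t w], those of the pair over [w] by [r p], up to the common factor
    [nu i ^- 1/2], so that the two middle points coincide. By homogeneity of the
    cost each term of the triangle inequality is a product, which Tonelli's theorem
    integrates. *)
Lemma HK_le_glue : HK xbar mu1 mu2 <=
  sqrte (4%:E * (\int[m1]_p (c1 p)%:E + \int[m2]_w (c2 w)%:E)).
Proof.
have [M ME] := finite_product m1 m2.
have mW1 := @measurable_fst _ _ W1 W2; have mW2 := @measurable_snd _ _ W1 W2.
have scomp d d' (V : measurableType d) (W : measurableType d') (x : W -> X) (g : V -> W) :
    strongly_measurable x -> measurable_fun setT g -> strongly_measurable (x \o g).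
  move=> [h ch hx] mg; exists (fun k => h k \o g) => [k|v]; last exact: hx.
  have [n [c [mn ->]]] := ch k; exists (n \o g), c; split => //.
  exact: measurableT_comp.
have mR1 : measurable_fun setT (fun z => e1 z * r1 z.1)%R.
  by apply: measurable_funM => //; exact: (measurableT_comp mr1).
have mR2 : measurable_fun setT (fun z => e2 z * r2 z.2)%R.
  by apply: measurable_funM => //; exact: (measurableT_comp mr2).
have R10 z : (0 <= e1 z * r1 z.1)%R by rewrite mulr_ge0.
have R20 z : (0 <= e2 z * r2 z.2)%R by rewrite mulr_ge0.
have w1 p : \int[m2]_w (e1 (p, w) ^+ 2)%:E = 1 := integral_unit_weight m2T mJ mt nuJ (K p).
have w2 w : \int[m1]_p (e2 (p, w) ^+ 2)%:E = 1 := integral_unit_weight m1T mK mr nuK (J w).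
have mx1 := strongly_measurable_borel sx1.
have mx2 := strongly_measurable_borel sx2.
have RE1 : realizes M (x1 \o fst) (fun z => e1 z * r1 z.1)%R mu1.
  move=> A mA; rewrite ME integral_mkcond -(re1 mA) [RHS]integral_mkcond.
  have mA1 : measurable (x1 @^-1` A) by rewrite -[X in measurable X]setTI; exact: mx1.
  rewrite -(@integral_product_weight1 _ _ _ _ _ m1 m2 _ e1)//.
  - apply: eq_integral => -[p w] _; rewrite !patchE/=.
    have -> : ((p, w) \in (x1 \o fst) @^-1` A) = (p \in x1 @^-1` A).
      by apply/idP/idP; rewrite !inE.
    by case: ifP => _; rewrite ?mul0e// exprMn EFinM muleC.
  - apply/(measurable_restrictT _ mA1); apply: measurable_funTS.
    by apply/measurable_EFinP; exact: measurable_funX.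
  - by move=> p; rewrite patchE; case: ifP => // _; rewrite lee_fin sqr_ge0.
have RE2 : realizes M (x2 \o snd) (fun z => e2 z * r2 z.2)%R mu2.
  move=> A mA; rewrite ME integral_mkcond -(re2 mA) [RHS]integral_mkcond.
  have mA2 : measurable (x2 @^-1` A) by rewrite -[X in measurable X]setTI; exact: mx2.
  rewrite -(@integral_product_weight2 _ _ _ _ _ m1 m2 _ e2)//.
  - apply: eq_integral => -[p w] _; rewrite !patchE/=.
    have -> : ((p, w) \in (x2 \o snd) @^-1` A) = (w \in x2 @^-1` A).
      by apply/idP/idP; rewrite !inE.
    by case: ifP => _; rewrite ?mul0e// exprMn EFinM muleC.
  - apply/(measurable_restrictT _ mA2); apply: measurable_funTS.
    by apply/measurable_EFinP; exact: measurable_funX.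
  - by move=> p; rewrite patchE; case: ifP => // _; rewrite lee_fin sqr_ge0.
have sX1 := scomp _ _ _ _ _ _ sx1 mW1; have sX2 := scomp _ _ _ _ _ _ sx2 mW2.
apply: le_trans (HK_le_cost sepX xbar sX1 sX2 mR1 mR2 R10 R20 RE1 RE2) _.
have c1_0 p : (0 <= c1 p)%R by exact: cone_cost_ge0.
have c2_0 w : (0 <= c2 w)%R by exact: cone_cost_ge0.
have n1_0 p : (0 <= n1 p)%R by rewrite /n1; case: ifP => // _; exact: sqr_ge0.
have n2_0 w : (0 <= n2 w)%R by rewrite /n2; case: ifP => // _; exact: sqr_ge0.
have mc1 : measurable_fun setT c1.
  apply: strongly_measurable_cost => //; apply: countably_valued_strongly.
  by exists K, s.
have mc2 : measurable_fun setT c2.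
  apply: strongly_measurable_cost => //; apply: countably_valued_strongly.
  by exists J, s.
have mn1 : measurable_fun setT n1.
  apply: measurable_fun_ifT => //; last exact: measurable_funX.
  exact: (measurable_nat2 (fun i _ => (0 < nu i)%R) mK mK).
have mn2 : measurable_fun setT n2.
  apply: measurable_fun_ifT => //; last exact: measurable_funX.
  exact: (measurable_nat2 (fun i _ => (0 < nu i)%R) mJ mJ).
rewrite lee_sqrt; last first.
  by rewrite mule_ge0// adde_ge0//; apply: integral_ge0 => ? _; rewrite lee_fin.
have mcn1 : measurable_fun setT (fun p => (c1 p + n1 p)%:E).
  by apply/measurable_EFinP; exact: measurable_funD.
have mcn2 : measurable_fun setT (fun p => (c2 p + n2 p)%:E).
  by apply/measurable_EFinP; exact: measurable_funD.
have mg1 : measurable_fun setT (fun z : W1 * W2 => (c1 z.1 + n1 z.1)%:E * (e1 z ^+ 2)%:E).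
  apply: emeasurable_funM; first exact: (measurableT_comp mcn1 mW1).
  by apply/measurable_EFinP; exact: measurable_funX.
have mg2 : measurable_fun setT (fun z : W1 * W2 => (c2 z.2 + n2 z.2)%:E * (e2 z ^+ 2)%:E).
  apply: emeasurable_funM; first exact: (measurableT_comp mcn2 mW2).
  by apply/measurable_EFinP; exact: measurable_funX.
have g10 z : 0 <= (c1 z.1 + n1 z.1)%:E * (e1 z ^+ 2)%:E.
  by rewrite -EFinM lee_fin; apply: mulr_ge0; [exact: addr_ge0|exact: sqr_ge0].
have g20 z : 0 <= (c2 z.2 + n2 z.2)%:E * (e2 z ^+ 2)%:E.
  by rewrite -EFinM lee_fin; apply: mulr_ge0; [exact: addr_ge0|exact: sqr_ge0].
apply: (@le_trans _ _ (\int[M]_z (4%:E * ((c1 z.1 + n1 z.1)%:E * (e1 z ^+ 2)%:E +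
     (c2 z.2 + n2 z.2)%:E * (e2 z ^+ 2)%:E)))).
  apply: ge0_le_integral => //.
  - by move=> z _; rewrite lee_fin cone_cost_ge0.
  - by apply/measurable_EFinP; exact: (strongly_measurable_cost sX1 sX2 mR1 mR2).
  - by apply: measurable_funeM; exact: emeasurable_funD.
  - by move=> z _; have := glued_cost z; rewrite -lee_fin.
rewrite ME ge0_integralZl_EFin//; last 2 first.
- by move=> z _; rewrite adde_ge0.
- exact: emeasurable_funD.
apply: lee_wpmul2l; first by rewrite lee_fin.
have cn1_0 p : 0 <= (c1 p + n1 p)%:E by rewrite lee_fin addr_ge0.
have cn2_0 w : 0 <= (c2 w + n2 w)%:E by rewrite lee_fin addr_ge0.
have I1 := integral_product_weight1 m1 mcn1 cn1_0 me1 w1.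
have I2 := integral_product_weight2 m2 mcn2 cn2_0 me2 w2.
rewrite ge0_integralD//; apply: leeD.
  apply: (@le_trans _ _ (\int[m1]_p (c1 p + n1 p)%:E)).
    by rewrite -I1; exact: lexx.
  under eq_integral do rewrite EFinD.
  rewrite ge0_integralD//; last 4 first.
  - by move=> p _; rewrite lee_fin.
  - exact/measurable_EFinP.
  - by move=> p _; rewrite lee_fin.
  - exact/measurable_EFinP.
  by rewrite (integral_null_cells mK mr nuK) adde0.
apply: (@le_trans _ _ (\int[m2]_w (c2 w + n2 w)%:E)).
  by rewrite -I2; exact: lexx.
under eq_integral do rewrite EFinD.
rewrite ge0_integralD//; last 4 first.
- by move=> p _; rewrite lee_fin.
- exact/measurable_EFinP.
- by move=> p _; rewrite lee_fin.
- exact/measurable_EFinP.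
by rewrite (integral_null_cells mJ mt nuJ) adde0.
Qed.

End gluing.

(** * Completeness *)

Section completeness.
Context {R : realType} {X : completePseudoMetricType R}.
Hypothesis sepX : separable X.
Local Open Scope ereal_scope.

(** Mass at the pair of vertices is invisible to marginals and cost. It is added
    because [HK_le_glue] needs a nonzero measure, and the zero plan is a plan
    between zero measures. *)
Lemma integral_add_vertex (alpha : {finite_measure set (borel (cone X * cone X)%type) -> \bar R}) :
  exists beta : {finite_measure set (borel (cone X * cone X)%type) -> \bar R},
    0 < beta setT /\
    forall (D : set (borel (cone X * cone X)%type)) (g : borel (cone X * cone X)%type -> \bar R),
      measurable D -> measurable_fun setT g -> (forall p, 0 <= g p) ->
      g (conept (point, 0%R), conept (point, 0%R)) = 0 ->
      \int[beta]_(p in D) g p = \int[alpha]_(p in D) g p.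
Proof.
pose o : borel (cone X * cone X)%type := (conept (point, 0%R), conept (point, 0%R)).
have [|beta betaE] := @finite_measure_of R _ _ (measure_add alpha \d_o).
  rewrite /= /measure_add/= /msum !big_ord_recl/= big_ord0 adde0.
  by rewrite lte_add_pinfty// ?diracT ?ltry// ltey_eq fin_num_measure.
exists beta; split.
  rewrite betaE /= /measure_add/= /msum !big_ord_recl/= big_ord0 adde0.
  by rewrite diracT; apply: (@lt_le_trans _ _ 1); rewrite ?lte_fin// leeDr.
move=> D g mD mg g0 go.
rewrite (eq_measure_integral (measure_add alpha \d_o)); last by move=> A mA _; exact: betaE.
rewrite ge0_integral_measure_add//; last exact: measurable_funTS.
by rewrite integral_dirac ?go ?mule0 ?adde0//; exact: measurable_funTS.
Qed.

Lemma HK_lt_realize_pos (xbar : X) (mu1 mu2 : radon_measure R X) (e : R) :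
  (0 < e)%R -> HK xbar mu1 mu2 < e%:E ->
  exists alpha : {finite_measure set (borel (cone X * cone X)%type) -> \bar R},
    let x (p : cone X) := cone_pt xbar p in
    [/\ 0 < alpha setT,
        realizes alpha (x \o fst) (@cone_rad R X \o fst) mu1,
        realizes alpha (x \o snd) (@cone_rad R X \o snd) mu2 &
        \int[alpha]_p (cone_cost (x p.1) (cone_rad p.1) (x p.2) (cone_rad p.2))%:E
          < (e ^+ 2)%:E].
Proof.
move=> e0 /(HK_lt_realize e0)[alpha [re1 re2 cost]].
have [beta [beta0 betaE]] := integral_add_vertex alpha.
have [mx1 mx2 mr1 mr2] := measurable_cone_maps xbar.
exists beta; split=> // [A mA|A mA|].
- rewrite betaE -?re1//.
  + by rewrite -[X in measurable X]setTI; exact: mx1.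
  + by apply/measurable_EFinP; exact: measurable_funX.
  + by move=> p; rewrite lee_fin sqr_ge0.
  + by rewrite /= cone_rad_conept// expr0n.
- rewrite betaE -?re2//.
  + by rewrite -[X in measurable X]setTI; exact: mx2.
  + by apply/measurable_EFinP; exact: measurable_funX.
  + by move=> p; rewrite lee_fin sqr_ge0.
  + by rewrite /= cone_rad_conept// expr0n.
- rewrite betaE//.
  + apply/measurable_EFinP.
    have sx1 := borel_strongly_measurable sepX mx1.
    have sx2 := borel_strongly_measurable sepX mx2.
    exact: (strongly_measurable_cost sx1 sx2 mr1 mr2).
  + by move=> p; rewrite lee_fin cone_cost_ge0.
  + by rewrite /= cone_rad_conept// cone_cost0 expr0n.
Qed.

Lemma radon_realized {d} {W : measurableType d} (m : {finite_measure set W -> \bar R})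
    (x : W -> X) (r : W -> R) :
  strongly_measurable x -> measurable_fun setT r ->
  \int[m]_w (r w ^+ 2)%:E < +oo ->
  exists l : radon_measure R X, realizes m x r l.
Proof.
move=> sx mr roo.
have mr2 : measurable_fun setT (fun w => (r w ^+ 2)%:E).
  by apply/measurable_EFinP; exact: measurable_funX.
have r20 w : 0 <= (r w ^+ 2)%:E by rewrite lee_fin sqr_ge0.
have [nu nuE] := @finite_density R _ _ m _ mr2 r20 roo.
have [mu muE _] := finite_pushforward nu (strongly_measurable_borel sx).
have [l lE] := radon_of_tight (ulam mu sepX).
by exists l => A mA; rewrite lE muE nuE.
Qed.

Lemma quantizer_ex (s : nat -> X) (mu : radon_measure R X) (e : R) :
  (forall eta : R, (0 < eta)%R -> exists2 f : X -> nat,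
     measurable_fun setT (f : borel X -> nat) &
     forall x r, (cone_cost x r (s (f x)) r <= eta * r ^+ 2)%R) ->
  (0 < e)%R -> exists f, quantizes s f mu e.
Proof.
move=> ds e0.
have muT : (0 <= fine (mu setT))%R by rewrite fine_ge0.
have mu1 : (0 < fine (mu setT) + 1)%R by rewrite ltr_wpDl.
have eta0 : (0 < e / (fine (mu setT) + 1))%R by rewrite divr_gt0.
have [f mf fP] := ds _ eta0; exists f; split=> //.
exists (e / (fine (mu setT) + 1))%R; split=> //.
by rewrite mulrAC ler_pdivrMr// ler_pM2l// lerDl.
Qed.

(** The limit is the homogeneous marginal of the limit of the chain. Closeness of
    every late [u i] to it comes from gluing a plan between [u i] and [u (n k)]
    to the pair formed by the [k]-th random point and the limit, so that the whole
    sequence converges along with the subsequence. *)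
Lemma HK_complete (xbar : X) : complete_for (@HK R X xbar).
Proof.
move=> u cauchy_u.
have pos k : (0 < 2 ^- k :> R)%R by rewrite invr_gt0 exprn_gt0.
have /choice[N NP] k := cauchy_u _ (pos k).
(* running maxima, so that [n k.+1] is beyond [N k] as well *)
pose n k := (\max_(i < k.+1) N i)%N.
have nN k : (N k <= n k)%N by rewrite /n big_ord_recr/= leq_maxr.
have nS k : (n k <= n k.+1)%N by rewrite [leqRHS]/n big_ord_recr/= leq_maxl.
pose v k := u (n k).
have HKv k : HK xbar (v k) (v k.+1) < (2 ^- k)%:E.
  by apply: NP => //; exact: leq_trans (nN k) (nS k).
have [s ds] := @small_cost_quantizer R X sepX.
have /choice[f qf] k : exists f, quantizes s f (v k) (4 ^- k)%R.
  by apply: quantizer_ex ds _; rewrite invr_gt0 exprn_gt0.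
have [m [J [rho [m0 mJrho rho0 marg cost]]]] := chain_realization sepX qf HKv.
have mJ k := (mJrho k).1; have mrho k := (mJrho k).2.
have M0 : (0 <= 48 :> R)%R by [].
have [y [t [sy mt t0 ylim]]] := realization_limit xbar mJ mrho rho0 M0 cost.
have [mf0 _] := qf 0%N.
have mrho2 : measurable_fun setT (fun w => (rho 0%N w ^+ 2)%:E).
  by apply/measurable_EFinP; exact: measurable_funX.
have rho2 : \int[m]_w (rho 0%N w ^+ 2)%:E = \int[v 0%N]_(x in setT) (cst 1 x).
  apply: (eq_integral_cells (c := J 0%N) (c' := f 0%N : borel X -> nat)) => //.
    by move=> w; rewrite lee_fin sqr_ge0.
  move=> i; rewrite !setTI marg integral_cst ?mul1e//; exact: measurable_cell.
have sx0 : strongly_measurable (fun w => s (J 0%N w)).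
  by apply: countably_valued_strongly; exists (J 0%N), s.
have my0 : measurable_fun setT (fun w => (cone_cost (s (J 0%N w)) (rho 0%N w) (y w) (t w))%:E).
  by apply/measurable_EFinP; exact: strongly_measurable_cost.
have toox : \int[m]_w (t w ^+ 2)%:E < +oo.
  apply: (@le_lt_trans _ _ (\int[m]_w (2%:E * ((rho 0%N w ^+ 2)%:E +
      (cone_cost (s (J 0%N w)) (rho 0%N w) (y w) (t w))%:E)))).
    apply: ge0_le_integral => //.
    - by move=> w _; rewrite lee_fin sqr_ge0.
    - by apply/measurable_EFinP; exact: measurable_funX.
    - by apply: measurable_funeM; exact: emeasurable_funD.
    - move=> w _; rewrite -EFinD -EFinM lee_fin.
      have := cone_cost_rad (s (J 0%N w)) (y w) (rho0 0%N w) (t0 w).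
      by have := sqr_ge0 (t w - 2 * rho 0%N w)%R; nra.
  rewrite ge0_integralZl_EFin//; last 2 first.
  - by move=> w _; rewrite -EFinD lee_fin addr_ge0 ?sqr_ge0 ?cone_cost_ge0.
  - exact: emeasurable_funD.
  rewrite ge0_integralD//; last 2 first.
  - by move=> w _; rewrite lee_fin sqr_ge0.
  - by move=> w _; rewrite lee_fin cone_cost_ge0.
  rewrite rho2 integral_cst// mul1e lte_mul_pinfty ?lee_fin// lte_add_pinfty//.
    by rewrite ltey_eq fin_num_measure.
  exact: le_lt_trans (ylim 0%N) (ltry _).
have [l rl] := radon_realized sy mt toox.
exists l.
(* 784 = 4 * (2 * (1 + 1) + 4 * 48): the factor of [HK_le_glue] times the cost up to
   the quantized measure and from there to the limit *)
have bound k i : (n k <= i)%N -> HK xbar (u i) l <= (Num.sqrt (784 / 2 ^+ k))%:E.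
  move=> ki.
  have := NP k i (n k) (leq_trans (nN k) ki) (nN k).
  rewrite -/(v k) => /(HK_lt_realize_pos (pos k))[alpha [alpha0 re1 re2 acost]].
  have [mx1 mx2 mr1 mr2] := measurable_cone_maps xbar.
  have [mf _] := qf k.
  have sx1 := borel_strongly_measurable sepX mx1.
  have sx2 := borel_strongly_measurable sepX mx2.
  have [mI sI] := strongly_measurable_quantize s mf mx2.
  have rad0 (pr : cone X * cone X -> cone X) p : (0 <= (@cone_rad R X \o pr) p)%R by exact: cone_rad_ge0.
  have midK j := quantizes_cell j (qf k) re2.
  have := @HK_le_glue R X sepX _ _ _ _ alpha m s _ _ _ _ (J k) (rho k) y t alpha0 m0 sx1 sy mI (mJ k)
    mr1 mr2 (mrho k) mt (rad0 fst) (rad0 snd) (rho0 k) t0 xbar _ _ _ _ re1 rl mf midK (marg k).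
  move=> /le_trans; apply.
  have -> : (Num.sqrt (784 / 2 ^+ k))%:E = sqrte (784 / 2 ^+ k)%:E by [].
  rewrite lee_sqrt; last first.
    by rewrite lee_fin; apply: divr_ge0; [exact: ler0n|exact: exprn_ge0].
  have qcost := quantizes_cost sepX (qf k) re2 mx2 mr2.
  have mc : measurable_fun setT (fun p : borel (cone X * cone X)%type =>
      (cone_cost (cone_pt xbar p.1) (cone_rad p.1) (cone_pt xbar p.2) (cone_rad p.2))%:E).
    by apply/measurable_EFinP; exact: (strongly_measurable_cost sx1 sx2 mr1 mr2).
  have mq : measurable_fun setT (fun p : borel (cone X * cone X)%type =>
      (cone_cost (cone_pt xbar p.2) (cone_rad p.2) (s (f k (cone_pt xbar p.2))) (cone_rad p.2))%:E).
    by apply/measurable_EFinP; exact: (strongly_measurable_cost sx2 sI mr2 mr2).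
  have c1 : \int[alpha]_p (cone_cost (cone_pt xbar p.1) (cone_rad p.1)
      (s (f k (cone_pt xbar p.2))) (cone_rad p.2))%:E <= (2 * (4 ^- k + 4 ^- k))%:E.
    apply: (@le_trans _ _ (\int[alpha]_p (2%:E *
      ((cone_cost (cone_pt xbar p.1) (cone_rad p.1) (cone_pt xbar p.2) (cone_rad p.2))%:E +
       (cone_cost (cone_pt xbar p.2) (cone_rad p.2) (s (f k (cone_pt xbar p.2))) (cone_rad p.2))%:E)))).
      apply: ge0_le_integral => //.
      - by move=> p _; rewrite lee_fin cone_cost_ge0.
      - by apply/measurable_EFinP; exact: (strongly_measurable_cost sx1 sI mr1 mr2).
      - by apply: measurable_funeM; exact: emeasurable_funD.
      - move=> p _; rewrite -EFinD -EFinM lee_fin.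
        by apply: cone_cost_triangle; exact: cone_rad_ge0.
    rewrite ge0_integralZl_EFin//; last 2 first.
    - by move=> p _; rewrite -EFinD lee_fin addr_ge0 ?cone_cost_ge0.
    - exact: emeasurable_funD.
    rewrite ge0_integralD//; last 2 first.
    - by move=> p _; rewrite lee_fin cone_cost_ge0.
    - by move=> p _; rewrite lee_fin cone_cost_ge0.
    rewrite EFinM; apply: lee_wpmul2l; first by rewrite lee_fin.
    rewrite EFinD; apply: leeD; last exact: qcost.
    by rewrite -sqr_half_power; exact: ltW.
  apply: (@le_trans _ _ (4%:E * ((2 * (4 ^- k + 4 ^- k))%:E + (4 * 48 / 2 ^+ k)%:E))).
    by apply: lee_wpmul2l; [rewrite lee_fin|exact: leeD].
  rewrite -EFinD -EFinM lee_fin.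
  have : (4 ^- k <= 2 ^- k :> R)%R.
    by rewrite lef_pV2 ?posrE ?exprn_gt0// lerXn2r ?nnegrE// ler_nat.
  lra.
have HK0 i : 0 <= HK xbar (u i) l by exact: sqrte_ge0.
have HKfin k i : (n k <= i)%N -> HK xbar (u i) l \is a fin_num.
  by move=> /bound h; rewrite ge0_fin_numE//; apply: le_lt_trans h (ltry _).
apply/fine_cvgP; split; first by exists (n 0%N) => // i /= ni; exact: HKfin ni.
apply/cvgrPdist_lt => e e0.
have [k kP] := half_powers_small 784 (exprn_gt0 2 e0).
exists (n k) => // i /= ki; rewrite sub0r normrN ger0_norm ?fine_ge0//.
apply: (@le_lt_trans _ _ (Num.sqrt (784 / 2 ^+ k))).
  by rewrite -lee_fin fineK ?(HKfin k)//; exact: bound.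
rewrite -(ger0_norm (ltW e0)) -sqrtr_sqr ltr_sqrt ?exprn_gt0//.
exact: kP.
Qed.

End completeness.

Theorem theorem7p17 (R : realType) (X : completePseudoMetricType R) (xbar : X) :
  is_extended_metric X -> separable X ->
  complete_for (@HK R X xbar).
Proof. by move=> _ sepX; exact: HK_complete. Qed.
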